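(* Let $(\mathcal{A},m)$ be a multiarrangement in $V=\mathbb{K}^\ell$ and $H\in\mathcal{A}$. (1) Suppose $(\mathcal{A},m)$ is free. Then $(\mathcal{A},m-\delta_H)$ is either free or SPOG. (2) Suppose $(\mathcal{A},m-\delta_H)$ is free. Then $(\mathcal{A},m)$ is either free or dual SPOG.
   Context: Let $\mathbb{K}$ be a field, $V=\mathbb{K}^\ell$, $S=\mathbb{K}[x_1,\dots,x_\ell]$ its coordinate ring, $\mathrm{Der}\,S=\bigoplus_i S\,\partial_{x_i}$, $\Omega^1_V=\bigoplus_i S\,dx_i$, $\Omega^p_V=\bigwedge^p\Omega^1_V$. An arrangement $\mathcal{A}$ is a finite set of linear hyperplanes in $V$; for each $H\in\mathcal{A}$ fix $\alpha_H\in V^*$ with $\ker\alpha_H=H$. A multiarrangement $(\mathcal{A},m)$ is an arrangement with a map $m\colon\mathcal{A}\to\mathbb{Z}_{>0}$; a multiplicity $0$ is also allowed and means that the hyperplane is deleted. Put $Q(\mathcal{A},m)=\prod_{H\in\mathcal{A}}\alpha_H^{m(H)}$ and $$D(\mathcal{A},m)=\{\theta\in\mathrm{Der}\,S\mid\theta(\alpha_H)\in S\alpha_H^{m(H)}\ \forall H\in\mathcal{A}\},$$ $$\Omega^1(\mathcal{A},m)=\Big\{\omega\in\tfrac{1}{Q(\mathcal{A},m)}\Omega^1_V\ \Big|\ \omega\wedge d\alpha_H\in\tfrac{\alpha_H^{m(H)}}{Q(\mathcal{A},m)}\Omega^2_V\ \forall H\in\mathcal{A}\Big\},$$ which are mutually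 dual graded $S$-modules of rank $\ell$ (with $\partial_{x_i}$ and $dx_i$ in degree $0$). $(\mathcal{A},m)$ is free if $D(\mathcal{A},m)$ (equivalently $\Omega^1(\mathcal{A},m)$) is a free $S$-module. For $H\in\mathcal{A}$ (with $m(H)\ge 1$), $\delta_H\colon\mathcal{A}\to\{0,1\}$ takes value $1$ exactly at $H$. $S[d]$ denotes the graded free module with $S[d]_k=S_{d+k}$. A graded $S$-module $M$ of rank $\ell$ is strongly plus-one generated (SPOG) if it has a minimal graded free resolution of the form $$0\to S[d-1]\xrightarrow{(f_1,\dots,f_\ell,\alpha)}\bigoplus_{i=1}^\ell S[d_i]\oplus S[d]\to M\to0$$ with $d,d_i\in\mathbb{Z}$, $f_i\in S$ and $0\ne\alpha\in V^*$ (a nonzero linear form). A multiarrangement $(\mathcal{A},m)$ is SPOG if $D(\mathcal{A},m)$ is an SPOG module, and dual SPOG if $\Omega^1(\mathcal{A},m)$ is an SPOG module. *)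

(* Defs.v *)
From HB Require Import structures.
From mathcomp Require Import all_boot all_order all_algebra.
From mathcomp Require Import finmap.
From mathcomp Require Import mpoly.

Set Implicit Arguments.
Unset Strict Implicit.
Unset Printing Implicit Defensive.

Import GRing.Theory.
Local Open Scope ring_scope.

(* [A] is the arrangement, [fset_sub_type A] its set of hyperplanes.  The
   dimension condition is written [(\dim H).+1 = l] rather than [\dim H = l.-1]
   so that the zero space is not a hyperplane when l = 0. *)
Definition is_arrangement (K : fieldType) (l : nat)
    (A : {fset {vspace 'rV[K]_l}}) : Prop :=
  forall H : A, (\dim (val H)).+1 = l.

Definition is_defining (K : fieldType) (l : nat)
    (A : {fset {vspace 'rV[K]_l}}) (alpha : A -> 'Hom('rV[K]_l, K^o)) : Prop :=
  forall H : A, lker (alpha H) = val H.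

Definition delta (K : fieldType) (l : nat) (A : {fset {vspace 'rV[K]_l}})
    (H : A) : A -> nat := fun H' => nat_of_bool (H' == H).

(* A linear form as a homogeneous polynomial of degree one. *)
Definition lin_poly (K : fieldType) (l : nat) (a : 'Hom('rV[K]_l, K^o)) :
    {mpoly K[l]} :=
  \sum_(i < l) (a (delta_mx 0 i) : K) *: 'X_i.

Definition Qpoly (K : fieldType) (l : nat) (A : {fset {vspace 'rV[K]_l}})
    (alpha : A -> 'Hom('rV[K]_l, K^o)) (m : A -> nat) : {mpoly K[l]} :=
  \prod_(H : A) lin_poly (alpha H) ^+ m H.

(* The row theta stands for the derivation \sum_i theta_i d/dx_i. *)
Definition der_apply (K : fieldType) (l : nat) (theta : 'rV[{mpoly K[l]}]_l)
    (p : {mpoly K[l]}) : {mpoly K[l]} :=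
  \sum_(i < l) theta 0 i * p^`M(i).

(* The condition is vacuous at H when m H = 0, which then amounts to deleting
   H; the same holds for [Omega1] below. *)
Definition Dmod (K : fieldType) (l : nat) (A : {fset {vspace 'rV[K]_l}})
    (alpha : A -> 'Hom('rV[K]_l, K^o)) (m : A -> nat)
    (theta : 'rV[{mpoly K[l]}]_l) : Prop :=
  forall H : A, exists g : {mpoly K[l]},
    der_apply theta (lin_poly (alpha H)) = g * lin_poly (alpha H) ^+ m H.

(* Rational 1-forms \sum_i w_i dx_i, as a module over the polynomial ring S
   (the canonical structure on rows is over the fraction field of S only). *)
Definition ratform (K : fieldType) (l : nat) : Type :=
  'rV[{fraction {mpoly K[l]}}]_l.

HB.instance Definition _ (K : fieldType) (l : nat) :=
  GRing.Zmodule.copy (ratform K l) 'rV[{fraction {mpoly K[l]}}]_l.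

Section RatformScale.
Variables (K : fieldType) (l : nat).
Implicit Types (a b : {mpoly K[l]}) (w : ratform K l).

Definition ratform_scale a w : ratform K l :=
  (tofrac a *: (w : 'rV[{fraction {mpoly K[l]}}]_l) :
     'rV[{fraction {mpoly K[l]}}]_l).

Fact ratform_scaleA a b w :
  ratform_scale a (ratform_scale b w) = ratform_scale (a * b) w.
Proof. by rewrite /ratform_scale scalerA tofracM. Qed.

Fact ratform_scale1 : left_id 1 ratform_scale.
Proof. by move=> w; rewrite /ratform_scale tofrac1 scale1r. Qed.

Fact ratform_scaleDr : right_distributive ratform_scale +%R.
Proof. by move=> a w w'; rewrite /ratform_scale -scalerDr. Qed.

Fact ratform_scaleDl w : {morph ratform_scale^~ w : a b / a + b}.
Proof. by move=> a b; rewrite /ratform_scale tofracD scalerDl. Qed.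

HB.instance Definition _ :=
  GRing.Zmodule_isLmodule.Build {mpoly K[l]} (ratform K l)
    ratform_scaleA ratform_scale1 ratform_scaleDr ratform_scaleDl.
End RatformScale.

Definition ratcoef (K : fieldType) (l : nat) (w : ratform K l) (i : 'I_l) :
    {fraction {mpoly K[l]}} :=
  (w : 'rV[{fraction {mpoly K[l]}}]_l) 0 i.

(* The differential dp of a polynomial p. *)
Definition dform (K : fieldType) (l : nat) (p : {mpoly K[l]}) : ratform K l :=
  \row_(i < l) tofrac (p^`M(i)).

(* Coefficient of dx_i /\ dx_j (i < j) in w /\ w'; these 2-forms are a basis
   of Omega^2. *)
Definition wedge (K : fieldType) (l : nat) (w w' : ratform K l) (i j : 'I_l) :
    {fraction {mpoly K[l]}} :=
  ratcoef w i * ratcoef w' j - ratcoef w j * ratcoef w' i.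

(* Membership of the rational function x in the fractional ideal q S. *)
Definition in_frac_ideal (K : fieldType) (l : nat)
    (q x : {fraction {mpoly K[l]}}) : Prop :=
  exists g : {mpoly K[l]}, x = q * tofrac g.

Definition Omega1 (K : fieldType) (l : nat) (A : {fset {vspace 'rV[K]_l}})
    (alpha : A -> 'Hom('rV[K]_l, K^o)) (m : A -> nat) (w : ratform K l) :
    Prop :=
  (forall i : 'I_l, in_frac_ideal (tofrac (Qpoly alpha m))^-1 (ratcoef w i)) /\
  (forall (H : A) (i j : 'I_l), (i < j)%N ->
     in_frac_ideal
       (tofrac (lin_poly (alpha H) ^+ m H) / tofrac (Qpoly alpha m))
       (wedge w (dform (lin_poly (alpha H))) i j)).

(* S_k for an integer k (zero when k < 0); 0 belongs to every S_k. *)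
Definition poly_deg (K : fieldType) (l : nat) (k : int) (p : {mpoly K[l]}) :
    Prop :=
  match k with
  | Posz d => p \is d.-homog
  | Negz _ => p = 0
  end.

Definition frac_deg (K : fieldType) (l : nat) (k : int)
    (x : {fraction {mpoly K[l]}}) : Prop :=
  exists (p q : {mpoly K[l]}) (e e' : nat),
    [/\ p \is e.-homog, q \is e'.-homog, q != 0,
        x = tofrac p / tofrac q & k = e%:Z - e'%:Z].

(* Gradings for which d/dx_i and dx_i have degree 0. *)
Definition der_deg (K : fieldType) (l : nat) (k : int)
    (theta : 'rV[{mpoly K[l]}]_l) : Prop :=
  forall i : 'I_l, poly_deg k (theta 0 i).

Definition form_deg (K : fieldType) (l : nat) (k : int) (w : ratform K l) :
    Prop :=
  forall i : 'I_l, frac_deg k (ratcoef w i).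

(* Degree-k part of the graded free module S[t_0] + ... + S[t_(r-1)], where
   S[d]_k = S_(d+k). *)
Definition twist_deg (K : fieldType) (l r : nat) (t : 'I_r -> int) (k : int)
    (v : 'rV[{mpoly K[l]}]_r) : Prop :=
  forall i : 'I_r, poly_deg (t i + k) (v 0 i).

(* In the next definitions a (graded) module is a submodule M of a module W,
   given as a predicate; deg k w means that w : W is homogeneous of degree k.
   All the modules considered are finitely generated. *)
Definition free_module (K : fieldType) (l : nat) (W : lmodType {mpoly K[l]})
    (M : W -> Prop) : Prop :=
  exists (r : nat) (b : 'I_r -> W),
    (forall w : W, M w <->
       exists c : 'I_r -> {mpoly K[l]}, w = \sum_(i < r) c i *: b i) /\
    (forall c : 'I_r -> {mpoly K[l]},
       \sum_(i < r) c i *: b i = 0 -> forall i, c i = 0).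

(* 0 -> (+)_j S[s_j] --B--> (+)_i S[t_i] --eps--> M -> 0 is a minimal graded
   free resolution: the maps preserve degrees, the sequence is exact, and the
   entries of B have no constant term (minimality). *)
Definition minimal_resolution (K : fieldType) (l : nat)
    (W : lmodType {mpoly K[l]}) (deg : int -> W -> Prop) (M : W -> Prop)
    (q p : nat) (s : 'I_q -> int) (t : 'I_p -> int)
    (B : 'M[{mpoly K[l]}]_(q, p))
    (eps : {linear 'rV[{mpoly K[l]}]_p -> W}) : Prop :=
  (forall k v, twist_deg s k v -> twist_deg t k (v *m B)) /\
  (forall k v, twist_deg t k v -> deg k (eps v)) /\
  injective (fun v : 'rV[{mpoly K[l]}]_q => v *m B) /\
  (forall v, eps v = 0 <-> exists u : 'rV[{mpoly K[l]}]_q, v = u *m B) /\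
  (forall w, M w <-> exists v, w = eps v) /\
  (forall i j, (B i j)@_0%MM = 0).

Definition SPOG_module (K : fieldType) (l : nat) (W : lmodType {mpoly K[l]})
    (deg : int -> W -> Prop) (M : W -> Prop) : Prop :=
  exists (d : int) (ds : 'I_l -> int) (f : 'rV[{mpoly K[l]}]_l)
         (a : 'Hom('rV[K]_l, K^o))
         (eps : {linear 'rV[{mpoly K[l]}]_(l + 1) -> W}),
    a != 0 /\
    minimal_resolution deg M
      (fun _ : 'I_1 => d - 1)
      (fun i : 'I_(l + 1) =>
         match split i with inl j => ds j | inr _ => d end)
      (row_mx f (lin_poly a)%:M) eps.

Definition multi_free (K : fieldType) (l : nat) (A : {fset {vspace 'rV[K]_l}})
    (alpha : A -> 'Hom('rV[K]_l, K^o)) (m : A -> nat) : Prop :=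
  free_module (Dmod alpha m).

Definition multi_SPOG (K : fieldType) (l : nat) (A : {fset {vspace 'rV[K]_l}})
    (alpha : A -> 'Hom('rV[K]_l, K^o)) (m : A -> nat) : Prop :=
  SPOG_module (@der_deg K l) (Dmod alpha m).

Definition multi_dual_SPOG (K : fieldType) (l : nat)
    (A : {fset {vspace 'rV[K]_l}}) (alpha : A -> 'Hom('rV[K]_l, K^o))
    (m : A -> nat) : Prop :=
  SPOG_module (@form_deg K l) (Omega1 alpha m).

(* Main.v *)
(* Let (theta_j) be a homogeneous basis of the free module and L a linear form
   defining H.  Multiplication by L carries the larger of the two modules into
   the smaller one, and modulo L what is gained or lost is governed by a single
   vector over S/(L):
   - for D(A,m) free, D(A,m-delta_H) consists of the (sum_j u_j theta_j)/L with
     u in U = {u | u Theta = 0 mod L}; the values at L show that U mod L has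
     rank one, and it is saturated;
   - for D(A,m-delta_H) free, with theta_j(L) = g_j L^(m(H)-1), the condition
     for sum_j c_j theta_j to lie in D(A,m) is sum_j c_j g_j = 0 mod L.
   Since S/(L) is a polynomial ring, hence a UFD, the vector can be replaced by
   a homogeneous primitive vector u, and the module D(A,m-delta_H), respectively
   the dual Omega^1(A,m) of D(A,m), is generated by the (dual) basis and one
   more element phi with L phi = sum_j u_j y_j.  This presentation is minimal
   unless some u_j is a nonzero constant, and then one generator is redundant. *)
Require Import Defs.
From HB Require Import structures.
From mathcomp Require Import all_boot all_order all_algebra.
From mathcomp Require Import finmap.
From mathcomp Require Import mpoly.
From mathcomp Require Import ring zify.
From Stdlib Require Import Classical.
Import GRing.Theory.
Local Open Scope ring_scope.

Set Implicit Arguments.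
Unset Strict Implicit.
Unset Printing Implicit Defensive.

(** * Unique factorization in polynomial rings *)

(** Freeness provides an arbitrary basis, of unknown size and possibly inhomogeneous, whereas a
    plus-one resolution is graded with exactly l+1 generators. The module contains Q S^l and is
    closed under homogeneous components: the first property forces rank l, the second supplies
    homogeneous generators, and l of them are selected by the constant terms of their coordinates.
    The change of basis is invertible because its determinant divides a homogeneous polynomial and
    has nonzero constant term.

    Rank one over S/(L) alone does not make U mod L cyclic: one needs a vector of which every
    parallel vector is a multiple, and over a UFD a primitive vector is such. Hence unique
    factorization comes first. Restriction to ker L and a degree-preserving section move vectors
    between S/(L) and S.

    All relations are multiples of (u, L) because L is prime and misses some u_j. In (2) the
    resolved module is the dual of D(A,m), identified with Omega^1(A,m) by contraction; since
    freeness is stated for D(A,m), a constant u_j has to be turned into a basis of D(A,m) itself. *)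

Section Primes.
Variable R : idomainType.
Implicit Types a b c p x y : R.

Definition divides a b := exists c, b = a * c.

Definition prime_elt p :=
  [/\ p != 0, p \isn't a GRing.unit &
      forall a b, divides p (a * b) -> divides p a \/ divides p b].

Inductive prime_product : nat -> R -> Prop :=
| PrimeProductUnit a : a \is a GRing.unit -> prime_product 0 a
| PrimeProductMul k p a :
    prime_elt p -> prime_product k a -> prime_product k.+1 (p * a).

(** Existence suffices: a factorization into prime elements is automatically unique up to order and
    units. *)
Definition ufd := forall a, a != 0 -> exists k, prime_product k a.

Definition irreducible_elt a :=
  [/\ a != 0, a \isn't a GRing.unit &
      forall x y, a = x * y -> x \is a GRing.unit \/ y \is a GRing.unit].

Lemma divides_mulr a b c : divides a b -> divides a (b * c).
Proof. by case=> d ->; exists (d * c); rewrite mulrA. Qed.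

Lemma divides_mull a b c : divides a b -> divides a (c * b).
Proof. by rewrite mulrC; apply: divides_mulr. Qed.

Lemma dividesD a b c : divides a b -> divides a c -> divides a (b + c).
Proof. by move=> [x ->] [y ->]; exists (x + y); rewrite mulrDr. Qed.

Lemma dividesB a b c : divides a b -> divides a c -> divides a (b - c).
Proof. by move=> [x ->] [y ->]; exists (x - y); rewrite mulrBr. Qed.

Lemma divides_sum a (I : finType) (F : I -> R) :
  (forall i, divides a (F i)) -> divides a (\sum_i F i).
Proof.
by move=> h; elim/big_ind: _ => // [|x y]; [exists 0; rewrite mulr0 | exact: dividesD].
Qed.

Lemma prime_product_unit a : prime_product 0 a -> a \is a GRing.unit.
Proof. by move=> h; inversion h. Qed.

(** Each prime factor of x y divides x or y and is moved there. The counts add up, which makes the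
    number of prime factors usable as an induction measure. *)
Lemma prime_product_split k a : prime_product k a ->
  forall x y, a = x * y ->
  exists i j, [/\ prime_product i x, prime_product j y & (i + j = k)%N].
Proof.
elim=> [{}a ua|{}k p {}a pp _ IH] x y e.
  move: ua; rewrite e unitrM => /andP[ux uy].
  by exists 0%N, 0%N; split=> //; apply: PrimeProductUnit.
have [p0 pn pd] := pp.
have /pd [[x' ex]|[y' ey]] : divides p (x * y) by exists a.
  have /IH[i [j [hi hj <-]]] : a = x' * y.
    by apply: (mulfI p0); rewrite e ex mulrA.
  by exists i.+1, j; split=> //; rewrite ex; apply: PrimeProductMul.
have /IH[i [j [hi hj <-]]] : a = x * y'.
  by apply: (mulfI p0); rewrite e ey mulrCA.
by exists i, j.+1; split=> //; rewrite ?addnS // ey; apply: PrimeProductMul.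
Qed.

Lemma prime_productM i x j y :
  prime_product i x -> prime_product j y -> prime_product (i + j) (x * y).
Proof.
move=> hx hy; elim: hx => [a ua|k p a pp _ IH]; last first.
  by rewrite -mulrA addSn; apply: PrimeProductMul.
elim: hy => [b ub|k p b pp _ IH].
  by apply: PrimeProductUnit; rewrite unitrM ua.
by rewrite mulrCA; apply: PrimeProductMul.
Qed.

End Primes.

(** * Gauss's lemma and unique factorization in R[X] *)

Section Gauss.
Variable R : idomainType.
Implicit Types (c p : R) (f g h q r : {poly R}).

Lemma divides_polyC p f : divides p%:P f <-> forall i, divides p f`_i.
Proof.
split=> [[g ->] i|H]; first by exists g`_i; rewrite coefCM.
(* The quotients are only known to exist one coefficient at a time; finitely many are collected by
   induction. *)
have {}H : forall n, exists g, forall i, (i < n)%N -> f`_i = p * g`_i.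
  elim=> [|n [g hg]]; first by exists 0.
  have [c hc] := H n.
  exists (\poly_(i < n.+1) (if i == n then c else g`_i)) => i hi.
  rewrite coef_poly hi; case: eqP => [->//|/eqP ne]; apply: hg.
  by rewrite ltn_neqAle ne -ltnS.
have [g hg] := H (size f); exists (\poly_(i < size f) g`_i).
apply/polyP => i; rewrite coefCM coef_poly; case: ltnP => [/hg//|hi].
by rewrite mulr0 nth_default.
Qed.

(** Gauss's lemma. If p divides f g, it divides the product of the leading coefficients, hence one
    of them; removing that leading term lowers the total size and keeps the product divisible by
    p. *)
Lemma prime_polyC p : prime_elt p -> prime_elt p%:P.
Proof.
case=> p0 pn pd; split; first by rewrite polyC_eq0.
  by rewrite poly_unitE size_polyC p0 coefC.
move=> f g; move: {2}(_ + _)%N (leqnn (size f + size g)) => N.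
elim: N f g => [|N IH] f g hN hfg.
  left; move: hN; rewrite leqn0 addn_eq0 size_poly_eq0 => /andP[/eqP-> _].
  by exists 0; rewrite mulr0.
have [->|f0] := eqVneq f 0; first by left; exists 0; rewrite mulr0.
have [->|g0] := eqVneq g 0; first by right; exists 0; rewrite mulr0.
have size_tail (u : {poly R}) : u != 0 ->
    (size (u - (lead_coef u)%:P * 'X^((size u).-1))%R < size u)%N.
  move=> u0; rewrite -[X in (_ < X)%N]prednK ?size_poly_gt0 // ltnS.
  apply/leq_sizeP => j hj; rewrite coefB coefCM coefXn.
  have [->|ne] := eqVneq j (size u).-1; first by rewrite mulr1 subrr.
  rewrite mulr0 subr0 nth_default //.
  by move: hj; rewrite leq_eqVlt eq_sym (negPf ne) /= prednK // size_poly_gt0.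
have lead_tail (u v : {poly R}) : divides p (lead_coef u) ->
    divides p%:P (u * v) ->
    divides p%:P ((u - (lead_coef u)%:P * 'X^((size u).-1)) * v).
  case=> c -> huv; rewrite mulrBl; apply: dividesB => //.
  by exists (c%:P * 'X^((size u).-1) * v); rewrite polyCM; ring.
have tail_lead (u : {poly R}) : divides p (lead_coef u) ->
    divides p%:P (u - (lead_coef u)%:P * 'X^((size u).-1)) -> divides p%:P u.
  move=> [c hc] h; rewrite -[u](subrK ((lead_coef u)%:P * 'X^((size u).-1))).
  apply: dividesD => //; rewrite {1}hc.
  by exists (c%:P * 'X^((size u).-1)); rewrite polyCM; ring.
have /pd [hf|hg] : divides p (lead_coef f * lead_coef g).
- by rewrite -lead_coefM; apply: (proj1 (divides_polyC _ _) hfg).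
- case: (IH _ _ _ (lead_tail _ _ hf hfg)) => [|h|]; last by right.
    by rewrite -ltnS; apply: leq_trans hN; rewrite ltn_add2r size_tail.
  by left; apply: tail_lead.
- rewrite mulrC in hfg.
  case: (IH _ _ _ (lead_tail _ _ hg hfg)) => [|h|]; last by left.
    by rewrite -ltnS; apply: leq_trans hN; rewrite addnC ltn_add2l size_tail.
  by right; apply: tail_lead.
Qed.

Lemma prime_product_polyC k c : prime_product k c -> prime_product k c%:P.
Proof.
elim=> [a ua|{}k p a pp _ IH].
  apply: PrimeProductUnit; rewrite poly_unitE coefC ua andbT size_polyC.
  by rewrite (contraTneq _ ua) // => ->; rewrite unitr0.
by rewrite polyCM; apply: PrimeProductMul => //; apply: prime_polyC.
Qed.

(** By Gauss's lemma each prime of c cancels against q or against r; [c'] collects those taken from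
    r. *)
Lemma prime_product_cancel k c : prime_product k c ->
  forall f q r, c%:P * f = q * r ->
  exists c' q' r', [/\ c' != 0, r = c'%:P * r', divides q' q & f = q' * r'].
Proof.
elim=> [a ua|{}k p a pp _ IH] f q r.
  move=> e; exists 1, (a^-1%:P * q), r; split; rewrite ?oner_eq0 ?mul1r //.
    by exists a%:P; rewrite mulrAC -polyCM mulVr ?mul1r.
  by rewrite -mulrA -e mulrA -polyCM mulVr ?mul1r.
rewrite polyCM -mulrA => e; have [P0 Pn Pd] := prime_polyC pp.
have [p0 _ _] := pp.
have /Pd [[q' eq]|[r' er]] : divides p%:P (q * r) by exists (a%:P * f).
  have /IH[c' [q1 [r1 [? ? [d hd] ?]]]] : a%:P * f = q' * r.
    by apply: (mulfI P0); rewrite e eq mulrA.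
  by exists c', q1, r1; split=> //; rewrite eq hd; exists (p%:P * d); rewrite mulrCA.
have /IH[c' [q1 [r1 [? er' ? ?]]]] : a%:P * f = q * r'.
  by apply: (mulfI P0); rewrite e er mulrCA.
exists (p * c'), q1, r1; split=> //; first by rewrite mulf_neq0.
by rewrite er er' polyCM mulrA.
Qed.

(** A prime p of c divides f h. It cannot divide f, which is irreducible of positive degree, so it
    divides h and cancels. *)
Lemma irreducible_divides_scale k c f : prime_product k c ->
  irreducible_elt f -> (1 < size f)%N ->
  forall g, divides f (c%:P * g) -> divides f g.
Proof.
move=> hc [f0 fn fi] sf; elim: hc => [a ua|{}k p a pp _ IH] g [h e].
  exists (a^-1%:P * h); rewrite mulrCA -e mulrA -polyCM mulVr // mul1r //.
have [P0 Pn Pd] := prime_polyC pp.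
have /Pd [[f' ef]|[h' eh]] : divides p%:P (f * h).
- by rewrite -e; exists (a%:P * g); rewrite polyCM mulrA.
- case: (fi _ _ ef) => u; first by rewrite u in Pn.
  move: u sf; rewrite poly_unitE => /andP[/eqP sf' _].
  by rewrite ef size_Cmul ?sf' //; case: pp.
- apply: IH; exists h'; apply: (mulfI P0).
  transitivity ((p * a)%:P * g); first by rewrite polyCM mulrA.
  by rewrite e eh mulrCA.
Qed.

(** Such an r plays the role of the gcd of f and g over the fraction field of R. *)
Lemma minimal_combination f g : f != 0 ->
  exists r, [/\ r != 0, exists A B : {poly R}, r = A * f + B * g &
    forall A B : {poly R}, (size (A * f + B * g)%R < size r)%N -> A * f + B * g = 0].
Proof.
move=> f0.
have : exists r, [/\ r != 0 & exists A B : {poly R}, r = A * f + B * g].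
  by exists f; split=> //; exists 1, 0; rewrite mul1r mul0r addr0.
case=> r; move: {2}(size r) (leqnn (size r)) => N.
elim: N r => [|N IH] r.
  by rewrite leqn0 size_poly_eq0 => /eqP -> []; rewrite eqxx.
move=> hN [r0 hr].
have [H|H] := classic (forall A B : {poly R}, (size (A * f + B * g)%R < size r)%N -> A * f + B * g = 0).
  by exists r.
have [A /not_all_ex_not [B h]] := not_all_ex_not _ _ H.
have [hs /eqP h0] := imply_to_and _ _ h.
apply: (IH (A * f + B * g)); first by rewrite -ltnS (leq_trans hs).
by split=> //; exists A, B.
Qed.

(* A combination of f and g of least degree divides both up to constants of R. *)
Lemma irreducible_poly_prime f :
  ufd R -> irreducible_elt f -> (1 < size f)%N -> prime_elt f.
Proof.
move=> U fi sf; have [f0 fn fi'] := fi; split=> // g h hgh.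
have [r [r0 [A0 [B0 er]] rmin]] := minimal_combination g f0.
(* In the pseudo-division of u by r the remainder is again a combination of f and g, smaller than r,
   hence zero. *)
have div_r u : (exists A B : {poly R}, u = A * f + B * g) -> exists k c q,
    prime_product k c /\ c%:P * u = q * r.
  move=> [A [B eu]].
  have [k hk] : exists k, prime_product k (lead_coef r ^+ scalp u r).
    by apply: U; rewrite expf_neq0 // lead_coef_eq0.
  exists k, (lead_coef r ^+ scalp u r), (u %/ r); split=> //.
  have := Pdiv.Idomain.divp_eq u r; have := ltn_modp u r; rewrite r0 -mul_polyC.
  move: (_ ^+ _) (u %/ r) (u %% r) => c q s hs e.
  have em : s = (c%:P * A - q * A0) * f + (c%:P * B - q * B0) * g.
    by rewrite -[LHS](addKr (q * r)) -e er eu; ring.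
  by rewrite e em rmin ?addr0 // -em.
have [k [c [q [hc ef]]]] : exists k c q, prime_product k c /\ c%:P * f = q * r.
  by apply: div_r; exists 1, 0; rewrite mul1r mul0r addr0.
have [k2 [c2 [q2 [hc2 eg]]]] : exists k c q, prime_product k c /\ c%:P * g = q * r.
  by apply: div_r; exists 0, 1; rewrite mul1r mul0r add0r.
have [c' [q' [r' [c'0 er' _ ef']]]] := prime_product_cancel hc ef.
(* If q' is a unit, f is associate to r', which divides a constant multiple of g. If r' is a unit, r
   is a constant c' up to a unit, so c' h is a combination of f h and g h, both multiples of f. *)
have [u|u] := fi' _ _ ef'.
  left; apply: (irreducible_divides_scale hc2 fi sf).
  by exists (q2 * c'%:P * q'^-1); rewrite eg er' {1}ef' -[r' in LHS](mulKr u); ring.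
right; have [k' hc'] := U _ c'0.
apply: (irreducible_divides_scale hc' fi sf).
have [t et] := hgh; exists (r'^-1 * (A0 * h + B0 * t)).
have -> : f * (r'^-1 * (A0 * h + B0 * t)) = r'^-1 * (A0 * f * h + B0 * (f * t)).
  by ring.
rewrite -et.
have -> : A0 * f * h + B0 * (g * h) = (A0 * f + B0 * g) * h by ring.
by rewrite -er er' -[LHS](mulKr u); ring.
Qed.

(** The measure is the size of f plus the number of primes in its leading coefficient, so that
    splitting off a constant nonunit factor also decreases it. *)
Lemma ufd_poly : ufd R -> ufd {poly R}.
Proof.
move=> U f f0.
have [k hk] : exists k, prime_product k (lead_coef f).
  by apply: U; rewrite lead_coef_eq0.
move: {2}(_ + _)%N (leqnn (size f + k)) => N.
elim: N f f0 k hk => [|N IH] f f0 k hk.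
  by rewrite leqn0 addn_eq0 size_poly_eq0 (negPf f0).
move=> hN.
have [/size1_polyC e|sf] := leqP (size f) 1.
  by exists k; rewrite e; apply: prime_product_polyC; move: hk; rewrite e lead_coefC coefC.
have [uf|nuf] := boolP (f \is a GRing.unit).
  by exists 0%N; apply: PrimeProductUnit.
have [H|H] := classic (forall x y, f = x * y -> x \is a GRing.unit \/ y \is a GRing.unit).
  exists 1%N; rewrite -[f]mulr1; apply: PrimeProductMul; last first.
    by apply: PrimeProductUnit; rewrite unitr1.
  by apply: irreducible_poly_prime.
have [g /not_all_ex_not [h gh]] := not_all_ex_not _ _ H.
have [e /not_or_and [/negP ng /negP nh]] := imply_to_and _ _ gh.
have [g0 h0] : g != 0 /\ h != 0 by apply/andP; rewrite -negb_or -mulf_eq0 -e.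
move: (hk); rewrite e lead_coefM => /prime_product_split - /(_ _ _ erefl) [i [j [hi hj eij]]].
have nontriv (u : {poly R}) n : u != 0 -> u \isn't a GRing.unit ->
    prime_product n (lead_coef u) -> (1 < size u + n)%N.
  case: n => [|n] u0 nu; last by rewrite addnS ltnS addn_gt0 size_poly_gt0 u0.
  move/prime_product_unit => ul; rewrite addn0 ltnNge; apply: contra nu.
  move=> /size1_polyC eu; move: ul; rewrite eu lead_coefC => ul.
  rewrite poly_unitE coefC eqxx ul andbT size_polyC.
  by rewrite (contraTneq _ ul) // => ->; rewrite unitr0.
have sg := nontriv _ _ g0 ng hi.
have sh := nontriv _ _ h0 nh hj.
have sz : (size g + size h = (size f).+1)%N.
  by rewrite e size_mul // prednK // addn_gt0 size_poly_gt0 g0.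
have hsum : (size g + i + (size h + j) = (size f + k).+1)%N.
  by rewrite addnACA sz eij.
have [i' hi'] : exists k, prime_product k g.
  apply: (IH _ g0 _ hi); rewrite -ltnS; apply: leq_trans hN.
  by rewrite -ltnS -hsum -[X in (X < _)%N]addn1 ltn_add2l.
have [j' hj'] : exists k, prime_product k h.
  apply: (IH _ h0 _ hj); rewrite -ltnS; apply: leq_trans hN.
  by rewrite -ltnS -hsum [X in (_ < X)%N]addnC -[X in (X < _)%N]addn1 ltn_add2l.
by exists (i' + j')%N; have := prime_productM hi' hj'; rewrite -e.
Qed.

End Gauss.

Lemma ufd_iso (A B : idomainType) (f : {rmorphism A -> B}) (g : {rmorphism B -> A}) :
  cancel f g -> cancel g f -> ufd B -> ufd A.
Proof.
move=> fK gK U a a0.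
have [k hk] : exists k, prime_product k (f a).
  by apply: U; rewrite -(rmorph0 f) (can_eq fK).
exists k; rewrite -[a]fK; elim: hk => {k} [b ub|k p b [p0 pn pd] _ IH].
  by apply: PrimeProductUnit; apply: rmorph_unit.
rewrite rmorphM; apply: PrimeProductMul => //; split.
- by rewrite -(rmorph0 g) (can_eq gK).
- by apply: contra pn => u; rewrite -[p]gK rmorph_unit.
- have tr x : divides (g p) x <-> divides p (f x).
    split=> [[c ->]|[c e]]; first by exists (f c); rewrite rmorphM gK.
    by exists (g c); rewrite -rmorphM -e fK.
  by move=> x y; rewrite !tr rmorphM; apply: pd.
Qed.

(** * Polynomial rings in several variables *)

Section MpolyUfd.
Variable K : fieldType.

Lemma eq_mpoly_rmorph n (S : comNzRingType) (f g : {rmorphism {mpoly K[n]} -> S}) :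
  (forall c, f c%:MP = g c%:MP) -> (forall i, f 'X_i = g 'X_i) -> f =1 g.
Proof.
move=> hC hX p; rewrite [p]mpolyE !rmorph_sum; apply: eq_bigr => m _.
rewrite -mul_mpolyC !rmorphM hC mpolyXE_id !rmorph_prod; congr (_ * _).
by apply: eq_bigr => i _; rewrite !rmorphXn hX.
Qed.

(** The last variable is singled out because [mwiden] embeds the other ones with unchanged
    indices. *)
Definition mpoly_to_poly n : {mpoly K[n.+1]} -> {poly {mpoly K[n]}} :=
  mmap (polyC \o @mpolyC n K)
       (fun i => if unlift ord_max i is Some j then ('X_j)%:P else 'X).

HB.instance Definition _ n := GRing.RMorphism.on (@mpoly_to_poly n).

Definition mpoly_of_poly n : {poly {mpoly K[n]}} -> {mpoly K[n.+1]} :=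
  horner_morph (fun p : {mpoly K[n]} => mulrC ('X_ord_max) (mwiden p)).

HB.instance Definition _ n := GRing.RMorphism.on (@mpoly_of_poly n).

Lemma lift_max_widen n (j : 'I_n) : lift ord_max j = widen_ord (leqnSn n) j.
Proof. by apply: val_inj; rewrite /= /bump leqNgt ltn_ord. Qed.

Lemma mpoly_to_polyK n : cancel (@mpoly_to_poly n) (@mpoly_of_poly n).
Proof.
pose fg := @mpoly_of_poly n \o @mpoly_to_poly n.
move=> p; apply: (@eq_mpoly_rmorph _ _ fg idfun) => [c|i] /=.
  by rewrite /mpoly_to_poly mmapC /= /mpoly_of_poly horner_morphC /= mwidenC.
rewrite /mpoly_to_poly mmapX mmap1U; case: unliftP => [j ->|->].
  by rewrite /mpoly_of_poly horner_morphC /= mwidenX mnmwiden1 lift_max_widen.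
by rewrite /mpoly_of_poly horner_morphX.
Qed.

Lemma mpoly_of_polyK n : cancel (@mpoly_of_poly n) (@mpoly_to_poly n).
Proof.
have hC (c : {mpoly K[n]}) : mpoly_to_poly (mwiden c) = c%:P.
  pose f : {rmorphism _ -> _} := @mpoly_to_poly n \o @mwiden n K.
  apply: (@eq_mpoly_rmorph _ _ f polyC) => [a|i] /=.
    by rewrite mwidenC /mpoly_to_poly mmapC.
  rewrite mwidenX mnmwiden1 /mpoly_to_poly mmapX mmap1U -lift_max_widen.
  by rewrite liftK.
elim/poly_ind => [|p c IH]; first by rewrite !rmorph0.
have -> : mpoly_of_poly (p * 'X + c%:P) = mpoly_of_poly p * 'X_ord_max + mwiden c.
  rewrite rmorphD rmorphM; congr (_ * _ + _).
    by rewrite /= /mpoly_of_poly horner_morphX.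
  by rewrite /= /mpoly_of_poly horner_morphC.
rewrite rmorphD rmorphM; congr (_ * _ + _); [exact: IH | | exact: hC].
by rewrite /= /mpoly_to_poly mmapX mmap1U unlift_none.
Qed.

Lemma ufd_mpoly n : ufd {mpoly K[n]}.
Proof.
elim: n => [|n IH].
  move=> a a0; exists 0%N; apply: PrimeProductUnit.
  rewrite unfold_in /= /mpoly_unit -nvar0_mpolyC eqxx unitfE.
  by apply: contraNneq a0 => h; rewrite [a]nvar0_mpolyC h mpolyC0.
by apply: ufd_iso (@mpoly_to_polyK n) (@mpoly_of_polyK n) _; apply: ufd_poly.
Qed.

End MpolyUfd.

(** * Homogeneous polynomials and linear forms *)

(** After the powers of X are removed from A and B, the constant terms are nonzero, so the order of
    the product is i + j = d. What remains has constant product c, hence is constant. *)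
Lemma monomial_factor (D : idomainType) (A B : {poly D}) (c : D) d :
  A * B = c%:P * 'X^d -> c != 0 -> exists i a, A = a%:P * 'X^i.
Proof.
move=> e c0.
have [i [A1]] := multiplicity_XsubC A 0.
have [j [B1]] := multiplicity_XsubC B 0.
rewrite polyC0 subr0 => hB eB hA eA.
have AB0 : A * B != 0 by rewrite e mulf_neq0 ?polyC_eq0 // -size_poly_eq0 size_polyXn.
move: AB0; rewrite mulf_eq0 negb_or => /andP[A0 B0].
move: hA hB; rewrite A0 B0 /= => hA hB.
have A10 : A1 != 0 by apply: contraNneq A0 => h; rewrite eA h mul0r.
have B10 : B1 != 0 by apply: contraNneq B0 => h; rewrite eB h mul0r.
have e1 : (A1 * B1) * 'X^(i + j) = c%:P * 'X^d by rewrite -e eA eB exprD; ring.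
have eij : (i + j = d)%N.
  have nz : (A1 * B1)`_0 != 0.
    by rewrite coef0M mulf_neq0 // -horner_coef0.
  have [lt|lt|//] := ltngtP (i + j)%N d.
    have := congr1 (fun p : {poly D} => p`_(i + j)) e1.
    rewrite /= (coefMXn _ (A1 * B1)) ltnn subnn coefCM coefXn (ltn_eqF lt) mulr0 => /eqP.
    by rewrite (negPf nz).
  have := congr1 (fun p : {poly D} => p`_d) e1.
  by rewrite /= (coefMXn _ (A1 * B1)) lt coefCM coefXn eqxx mulr1 => /esym/eqP; rewrite (negPf c0).
have e2 : A1 * B1 = c%:P.
  by apply: (mulIf (x := 'X^d)); rewrite ?expf_neq0 ?polyX_eq0 // -e1 eij.
have sA : (size A1 <= 1)%N.
  have := congr1 (fun p : {poly D} => size p) e2.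
  rewrite size_mul // size_polyC c0.
  have : (0 < size B1)%N by rewrite size_poly_gt0.
  have : (0 < size A1)%N by rewrite size_poly_gt0.
  by case: (size A1) (size B1) => [|x] [|y] //= _ _; rewrite addnS /=; case: x.
by exists i, A1`_0; rewrite {1}eA {1}(size1_polyC sA).
Qed.

Section Homog.
Variables (K : fieldType) (n : nat).
Implicit Types (p q a b : {mpoly K[n]}).

(* The substitution x_i |-> x_i t turns homogeneous components into
   coefficients of the powers of t. *)
Definition homog_poly : {mpoly K[n]} -> {poly {mpoly K[n]}} :=
  mmap (polyC \o @mpolyC n K) (fun i => ('X_i)%:P * 'X).

HB.instance Definition _ := GRing.RMorphism.on homog_poly.

Lemma coef_homog_poly p k : (homog_poly p)`_k = pihomog mdeg k p.
Proof.
rewrite /homog_poly /mmap coef_sum pihomogE [RHS]big_mkcond /=.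
apply: eq_bigr => m _; rewrite coefCM.
have -> : mmap1 (fun i : 'I_n => ('X_i)%:P * 'X : {poly {mpoly K[n]}}) m
          = ('X_[m])%:P * 'X^(mdeg m).
  rewrite /mmap1 (eq_bigr (fun i => ('X_i ^+ m i)%:P * 'X^(m i))); last first.
    by move=> i _; rewrite exprMn rmorphXn.
  by rewrite big_split /= -rmorph_prod -mpolyXE_id prodrXr mdegE.
rewrite coefCM coefXn eq_sym mul_mpolyC.
by case: eqP; rewrite ?mulr1 // !mulr0 scaler0.
Qed.

Lemma homog_poly_dhomog p d : p \is d.-homog -> homog_poly p = p%:P * 'X^d.
Proof.
move=> h; apply/polyP => k; rewrite coef_homog_poly coefCM coefXn eq_sym.
have [<-|ne] := eqVneq d k; first by rewrite pihomog_dE // mulr1.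
by rewrite (pihomog_ne0 ne h) mulr0.
Qed.

(** Under [homog_poly] a homogeneous product becomes a monomial in t, so each factor becomes one
    too, which means that it has a single homogeneous component. *)
Lemma dhomog_factor a b d : a * b \is d.-homog -> a * b != 0 ->
  exists i j, [/\ a \is i.-homog, b \is j.-homog & (i + j)%N = d].
Proof.
have half (x y : {mpoly K[n]}) : x * y \is d.-homog -> x * y != 0 -> exists i, x \is i.-homog.
  move=> h nz.
  have [i [c e]] : exists i c, homog_poly x = c%:P * 'X^i.
    apply: (@monomial_factor _ _ (homog_poly y) (x * y) d) => //.
    by rewrite -rmorphM; apply: homog_poly_dhomog.
  exists i; apply/dhomogP => m hm.
  have : (homog_poly x)`_(mdeg m) != 0.
    rewrite coef_homog_poly; apply/eqP => /(congr1 (mcoeff m)).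
    rewrite mcoeff0 pihomogE raddf_sum /= big_mkcond (bigD1_seq m) //= eqxx.
    rewrite mcoeffZ mcoeffX eqxx mulr1 big1 => [|m' ne]; last first.
      by case: ifP => // _; rewrite mcoeffZ mcoeffX (negPf ne) mulr0.
    by rewrite addr0; apply/eqP; rewrite -mcoeff_msupp.
  by rewrite e coefCM coefXn; have [//|_] := eqVneq (mdeg m) i; rewrite mulr0 eqxx.
move=> h nz; have [i hi] := half _ _ h nz.
have [j hj] : exists j, b \is j.-homog by apply: (half b a); rewrite mulrC.
by exists i, j; split=> //; apply: (dhomog_uniq nz) h; apply: dhomogM.
Qed.

Lemma pihomogM_homog k d p h : h \is d.-homog ->
  pihomog mdeg k (p * h) = if (d <= k)%N then pihomog mdeg (k - d) p * h else 0.
Proof.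
move=> hh; rewrite -coef_homog_poly rmorphM /= (homog_poly_dhomog hh) mulrA.
rewrite coefMXn ltnNge; case: leqP => //= _.
by rewrite coefMC coef_homog_poly.
Qed.

Lemma dhomog0_const p : p \is 0.-homog -> p = (p@_0)%:MP.
Proof.
move/dhomogP => h; apply/mpolyP => m; rewrite mcoeffC.
have [->|ne] := eqVneq m 0%MM; first by rewrite mulr1.
rewrite mulr0; apply: memN_msupp_eq0; apply: contra ne => /h.
by move/eqP; rewrite mdeg_eq0.
Qed.

Lemma dhomog_const p d : p \is d.-homog -> p@_0 != 0 -> d = 0%N.
Proof.
move/dhomogP => h nz; have /h <- : 0%MM \in msupp p by rewrite mcoeff_msupp.
exact: mdeg0.
Qed.

Lemma poly_deg0 k : poly_deg k (0 : {mpoly K[n]}).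
Proof. by case: k => //= d; apply: dhomog0. Qed.

Lemma poly_degD k p q : poly_deg k p -> poly_deg k q -> poly_deg k (p + q).
Proof. by case: k => [d|d] /= hp hq; [apply: dhomogD | rewrite hp hq addr0]. Qed.

Lemma poly_degB k p q : poly_deg k p -> poly_deg k q -> poly_deg k (p - q).
Proof.
by case: k => [d|d] /= hp hq; [apply: rpredB | rewrite hp hq subr0].
Qed.

Lemma poly_deg_sum k (I : finType) (F : I -> {mpoly K[n]}) :
  (forall i, poly_deg k (F i)) -> poly_deg k (\sum_i F i).
Proof.
by move=> h; elim/big_ind: _ => // [|x y]; [apply: poly_deg0 | apply: poly_degD].
Qed.

Lemma poly_degM j k p q : poly_deg j p -> poly_deg k q -> poly_deg (j + k) (p * q).
Proof.
case: j => [j|j] /=; last by move=> -> _; rewrite mul0r; apply: poly_deg0.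
case: k => [k|k] /=; last by move=> _ ->; rewrite mulr0; apply: poly_deg0.
exact: dhomogM.
Qed.

Lemma poly_deg_nat k p : poly_deg k p -> p != 0 -> exists2 d : nat, k = d & p \is d.-homog.
Proof. by case: k => [d|d] /=; [exists d | move=> ->; rewrite eqxx]. Qed.

Lemma poly_deg_divl d k a b : a \is d.-homog -> a != 0 ->
  poly_deg k (a * b) -> poly_deg (k - d%:Z) b.
Proof.
move=> ha a0; have [->|b0 h] := eqVneq b 0; first by move=> _; apply: poly_deg0.
have ab0 : a * b != 0 by rewrite mulf_neq0.
have [e -> he] := poly_deg_nat h ab0.
have [i [j [hi hj <-]]] := dhomog_factor he ab0.
by rewrite (dhomog_uniq a0 ha hi) PoszD addrAC subrr add0r.
Qed.

End Homog.

Lemma dhomogXU (K : fieldType) n (i : 'I_n) : ('X_i : {mpoly K[n]}) \is 1.-homog.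
Proof. by rewrite dhomogX; apply/eqP; apply: mdeg1. Qed.

(** * Linear forms and restriction to a hyperplane *)

Section LinPoly.
Variables (K : fieldType) (l : nat).
Implicit Types (a b : 'Hom('rV[K]_l, K^o)).

Lemma lin_poly_homog a : lin_poly a \is 1.-homog.
Proof.
by apply: rpred_sum => i _; apply/dhomogZ/dhomogXU.
Qed.

Lemma mcoeff_lin_poly a i : (lin_poly a)@_U_(i) = a (delta_mx 0 i).
Proof.
rewrite /lin_poly raddf_sum /= (bigD1 i) //= mcoeffZ mcoeffXU eqxx mulr1.
rewrite big1 ?addr0 // => j ne; by rewrite mcoeffZ mcoeffXU (negPf ne) mulr0.
Qed.

Lemma eq_Hom_delta a b : (forall i, a (delta_mx 0 i) = b (delta_mx 0 i)) -> a = b.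
Proof.
move=> h; apply/lfunP => v; rewrite [v]row_sum_delta !linear_sum.
by apply: eq_bigr => i _; rewrite !linearZ /= h.
Qed.

Lemma Hom_neq0 a : a != 0 -> exists i, a (delta_mx 0 i) != 0.
Proof.
move=> a0; have [//|H] := classic (exists i, a (delta_mx 0 i) != 0).
case/eqP: a0; apply: eq_Hom_delta => i; rewrite lfunE /=.
by apply/eqP; apply/negPn/negP => h; apply: H; exists i.
Qed.

Lemma lin_poly_neq0 a : a != 0 -> lin_poly a != 0.
Proof.
case/Hom_neq0 => i; apply: contraNneq => h.
by rewrite -mcoeff_lin_poly h mcoeff0.
Qed.

Lemma mderiv_lin_poly a i : (lin_poly a)^`M(i) = (a (delta_mx 0 i) : K)%:MP.
Proof.
rewrite /lin_poly raddf_sum /= (bigD1 i) //= mderivZ mderivX mnm1E eqxx.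
have -> : (U_(i) - U_(i))%MM = 0%MM by apply/mnmP => k; rewrite mnmBE subnn mnm0E.
rewrite mpolyX0 scale1r -mul_mpolyC mulr1 big1 ?addr0 // => j ne.
by rewrite mderivZ mderivX mnm1E (negPf ne) scale0r scaler0.
Qed.

End LinPoly.

Lemma lin_poly_ndivides1 (K : fieldType) l (a : 'Hom('rV[K]_l, K^o)) :
  a != 0 -> ~ divides (lin_poly a) 1.
Proof.
move=> a0 [c e].
have [i [j [hi _ ij]]] : exists i j, [/\ lin_poly a \is i.-homog, c \is j.-homog & (i + j = 0)%N].
  by apply: dhomog_factor; rewrite -e ?oner_eq0 ?dhomog1.
have := dhomog_uniq (lin_poly_neq0 a0) (lin_poly_homog a) hi.
by move: ij; case: i {hi}.
Qed.

Lemma mmap_homog (K : fieldType) m n (h : 'I_m -> {mpoly K[n]}) p d :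
  (forall i, h i \is 1.-homog) -> p \is d.-homog ->
  mmap (@mpolyC n K) h p \is d.-homog.
Proof.
move=> hh /dhomogP hp; rewrite /mmap big_seq; apply: rpred_sum => u hu.
rewrite mul_mpolyC; apply: dhomogZ; have <- : mdeg u = d := hp _ hu.
rewrite /mmap1 mdegE.
elim/big_ind2: _ => [|x x' y y' hx hy|i _]; first exact: dhomog1.
  exact: dhomogM.
by rewrite -[X in X.-homog]mul1n; apply: dhomogMn.
Qed.

(* Restriction to the hyperplane ker a, and its section given by the
   coordinates other than one in which a does not vanish. *)
Lemma hyperplane_restriction (K : fieldType) l (a : 'Hom('rV[K]_l, K^o)) :
  a != 0 -> exists (pi : {rmorphism {mpoly K[l]} -> {mpoly K[l.-1]}})
                   (iota : {rmorphism {mpoly K[l.-1]} -> {mpoly K[l]}}),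
  [/\ cancel iota pi,
      forall p, pi p = 0 <-> divides (lin_poly a) p,
      forall p d, p \is d.-homog -> pi p \is d.-homog,
      forall p d, p \is d.-homog -> iota p \is d.-homog &
      forall b : 'Hom('rV[K]_l, K^o), pi (lin_poly b) = 0 -> exists c, b = c *: a].
Proof.
case/Hom_neq0 => i0 c0.
pose c i : K := a (delta_mx 0 i).
(* The equation a = 0 solved for the coordinate [i0]. *)
pose X0 : {mpoly K[l.-1]} := - \sum_j (c (lift i0 j) / c i0) *: 'X_j.
pose h i := if unlift i0 i is Some j then 'X_j else X0.
pose pi : {rmorphism {mpoly K[l]} -> {mpoly K[l.-1]}} := mmap (@mpolyC _ K) h.
pose iota : {rmorphism {mpoly K[l.-1]} -> {mpoly K[l]}} :=
  mmap (@mpolyC _ K) (fun j => 'X_(lift i0 j)).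
have piC x : pi x%:MP = x%:MP by rewrite /= mmapC.
have iotaC x : iota x%:MP = x%:MP by rewrite /= mmapC.
have piZ x p : pi (x *: p) = x *: pi p by rewrite -!mul_mpolyC rmorphM piC.
have iotaZ x p : iota (x *: p) = x *: iota p by rewrite -!mul_mpolyC rmorphM iotaC.
have piX j : pi 'X_(lift i0 j) = 'X_j by rewrite /= mmapX mmap1U /h liftK.
have piX0 : pi 'X_i0 = X0 by rewrite /= mmapX mmap1U /h unlift_none.
have iotaX j : iota 'X_j = 'X_(lift i0 j) by rewrite /= mmapX mmap1U.
have hom p d : p \is d.-homog -> pi p \is d.-homog.
  apply: mmap_homog => i; rewrite /h; case: (unlift i0 i) => [j|].
    exact: dhomogXU.
  by rewrite rpredN; apply: rpred_sum => j _; apply/dhomogZ/dhomogXU.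
have ihom p d : p \is d.-homog -> iota p \is d.-homog.
  by apply: mmap_homog => j; apply: dhomogXU.
clearbody pi iota.
have lin_split b : lin_poly b = (b (delta_mx 0 i0) : K) *: 'X_i0
    + \sum_j (b (delta_mx 0 (lift i0 j)) : K) *: 'X_(lift i0 j).
  by rewrite /lin_poly (@bigD1_ord _ _ _ _ i0).
have pi_lin b : pi (lin_poly b) =
    \sum_j ((b (delta_mx 0 (lift i0 j)) : K) - (b (delta_mx 0 i0) : K) * (c (lift i0 j) / c i0)) *: 'X_j.
  rewrite lin_split rmorphD piZ piX0 rmorph_sum scalerN addrC /= scaler_sumr -sumrB.
  by apply: eq_bigr => j _; rewrite piZ piX scalerBl scalerA.
have X0E : 'X_i0 - iota X0 = (c i0)^-1%:MP * lin_poly a.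
  rewrite rmorphN opprK rmorph_sum lin_split mulrDr mul_mpolyC scalerA mulVf //.
  rewrite scale1r mul_mpolyC scaler_sumr; congr (_ + _); apply: eq_bigr => j _.
  by rewrite iotaZ iotaX scalerA mulrC.
exists pi, iota; split=> //.
- move=> p; pose f : {rmorphism _ -> _} := pi \o iota.
  apply: (@eq_mpoly_rmorph _ _ _ f idfun) => [x|j] /=.
    by rewrite (iotaC x) (piC x).
  by rewrite (iotaX j) (piX j).
(* The composite of [pi] and [iota] is the identity modulo [lin_poly a]: this holds on constants and
   variables and is stable under sums and products. So an element of the kernel of [pi] is a
   multiple of [lin_poly a]. *)
- have congr_X i : divides (lin_poly a) ('X_i - iota (pi 'X_i)).
    case: (unliftP i0 i) => [j ->|->]; first by rewrite piX iotaX subrr; exists 0; rewrite mulr0.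
    by rewrite piX0 X0E mulrC; exists (c i0)^-1%:MP.
  have mul_congr x y : divides (lin_poly a) (x - iota (pi x)) ->
      divides (lin_poly a) (y - iota (pi y)) -> divides (lin_poly a) (x * y - iota (pi (x * y))).
    move=> [u eu] [v ev]; exists (u * y + iota (pi x) * v).
    by rewrite mulrDr mulrA -eu mulrCA -ev !rmorphM; ring.
  have congr_p p : divides (lin_poly a) (p - iota (pi p)).
    rewrite [p]mpolyE !rmorph_sum -sumrB; elim/big_ind: _ => [|x y|m _].
    - by exists 0; rewrite mulr0.
    - exact: dividesD.
    rewrite -mul_mpolyC; apply: (mul_congr).
      by rewrite piC iotaC subrr; exists 0; rewrite mulr0.
    have one_congr : divides (lin_poly a) (1 - iota (pi 1)).
      by rewrite !rmorph1 subrr; exists 0; rewrite mulr0.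
    rewrite mpolyXE_id.
    apply: (big_ind (fun q => divides (lin_poly a) (q - iota (pi q)))) => [//|x y|i _].
      exact: (mul_congr).
    by elim: (m i) => [|k IH]; [exact: one_congr | rewrite exprS; apply: (mul_congr)].
  move=> p; split=> [e|[q ->]].
    by have := congr_p p; rewrite e rmorph0 subr0.
  rewrite rmorphM pi_lin big1 ?mul0r // => j _.
  by rewrite mulrCA divff // mulr1 subrr scale0r.
- move=> b; rewrite pi_lin => e; exists (b (delta_mx 0 i0) / c i0 : K).
  apply: eq_Hom_delta => i; rewrite lfunE /=.
  case: (unliftP i0 i) => [j ->|->]; last by rewrite /GRing.scale /= divfK.
  have := congr1 (mcoeff U_(j)) e; rewrite mcoeff0 raddf_sum /= (bigD1 j) //=.
  rewrite mcoeffZ mcoeffXU eqxx mulr1 big1 ?addr0 => [|k ne]; last first.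
    by rewrite mcoeffZ mcoeffXU (negPf ne) mulr0.
  by move/eqP; rewrite subr_eq0 => /eqP ->; rewrite /GRing.scale /= mulrA mulrAC.
Qed.

(** * Primitive vectors modulo a linear form, and homogeneous bases *)

(** A prime p of a divides every b u_j; it misses some u_j, hence divides b and cancels. *)
Lemma prime_product_parallel (R : idomainType) (r k : nat) (a : R) (u v : 'I_r -> R) :
  (forall p, prime_elt p -> exists j, ~ divides p (u j)) ->
  prime_product k a -> forall b, (forall j, a * v j = b * u j) ->
  exists b', forall j, v j = b' * u j.
Proof.
move=> hu; elim=> {k a} [a ua|k p a pp _ IH] b h.
  by exists (a^-1 * b) => j; rewrite -mulrA -h mulKr.
have [j hj] := hu _ pp; have [p0 _ pd] := pp.
have /pd [[b1 eb]|//] : divides p (b * u j) by exists (a * v j); rewrite -h mulrA.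
by apply: (IH b1) => i; apply: (mulfI p0); rewrite !mulrA h eb.
Qed.

(** Common primes are divided out one by one. Such a prime divides a nonzero homogeneous entry, so
    it is homogeneous and the grading survives with a shifted k; it is nonconstant, so the size of
    that entry drops. *)
Lemma homog_vector_primitive (K : fieldType) n r (e : 'I_r -> int) (k : int)
    (g : 'I_r -> {mpoly K[n]}) :
  (forall j, poly_deg (k - e j) (g j)) -> (exists j, g j != 0) ->
  exists k0 u h, [/\ forall j, poly_deg (k0 - e j) (u j), h != 0,
    forall j, g j = h * u j & forall p, prime_elt p -> exists j, ~ divides p (u j)].
Proof.
move=> hg [j0 g0]; move: {2}(msize (g j0)) (leqnn (msize (g j0))) => N.
elim: N g k hg g0 => [|N IH] g k hg g0 hN.
  by move: hN; rewrite leqn0 msize_poly_eq0 (negPf g0).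
have [H|H] := classic (forall p, prime_elt p -> exists j, ~ divides p (g j)).
  by exists k, g, 1; split=> // [|j]; rewrite ?oner_eq0 ?mul1r.
have [p hp] := not_all_ex_not _ _ H.
have [[p0 pn pd] hp'] := imply_to_and _ _ hp.
have /fin_all_exists [w hw] j : divides p (g j).
  by apply: NNPP => h; apply: hp'; exists j.
have nz : p * w j0 != 0 by rewrite -hw.
have [d _] := poly_deg_nat (hg j0) g0; rewrite hw => hd.
have [i [_ [hi _ _]]] := dhomog_factor hd nz.
have w0 : w j0 != 0 by apply: contraNneq g0; rewrite hw => ->; rewrite mulr0.
have sp : (1 < msize p)%N.
  rewrite ltnNge; apply: contra pn => /msize1_polyC e1.
  move: p0; rewrite e1 mpolyC_eq0 => p0.
  by rewrite unfold_in /= /mpoly_unit mcoeffC eqxx mulr1 eqxx unitfE.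
case: (IH w (k - i%:Z)) => //.
- by move=> j; rewrite addrAC; apply: (poly_deg_divl hi p0); rewrite -hw.
- rewrite -ltnS; apply: leq_trans hN; rewrite hw msizeM //.
  by case: (msize p) sp => [|[|s]] //= _; rewrite addSn /= ltnS leq_addl.
move=> k0 [u [h [hu h0 e1 prim]]]; exists k0, u, (p * h); split=> //.
  by rewrite mulf_neq0.
by move=> j; rewrite hw e1 mulrA.
Qed.

Section Hyperplane.
Variables (K : fieldType) (l : nat) (a : 'Hom('rV[K]_l, K^o)).
Hypothesis a0 : a != 0.
Local Notation L := (lin_poly a).

Lemma lin_poly_prime x y : divides L (x * y) -> divides L x \/ divides L y.
Proof.
have [pi [iota [_ ker _ _ _]]] := hyperplane_restriction a0.
move=> /ker /eqP; rewrite rmorphM mulf_eq0 => /orP[/eqP/ker|/eqP/ker]; tauto.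
Qed.

Lemma lin_poly_primeX x k : divides L (x ^+ k) -> divides L x.
Proof.
elim: k => [|k IH]; last by rewrite exprS => /lin_poly_prime [].
by rewrite expr0 -[1](expr0 x) => -[c e]; exists (c * x); rewrite mulrA -e expr0 mul1r.
Qed.

Lemma lin_poly_divides (b : 'Hom('rV[K]_l, K^o)) :
  divides L (lin_poly b) -> exists c, b = c *: a.
Proof.
have [pi [iota [_ ker _ _ hb]]] := hyperplane_restriction a0.
by move/ker/hb.
Qed.

(* Modulo L, u is g divided by the gcd of its entries. *)
Lemma primitive_part r (e : 'I_r -> int) (k : int) (g : 'I_r -> {mpoly K[l]}) :
  (forall j, poly_deg (k - e j) (g j)) -> ~ (forall j, divides L (g j)) ->
  exists k0 u h,
  [/\ forall j, poly_deg (k0 - e j) (u j), ~ divides L h,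
      exists j, ~ divides L (u j), forall j, divides L (g j - h * u j) &
      forall v, (forall i j, divides L (v i * u j - v j * u i)) ->
        exists b, forall j, divides L (v j - b * u j)].
Proof.
have [pi [iota [iK ker hpi hiota _]]] := hyperplane_restriction a0.
move=> hg /not_all_ex_not [j0 g0].
have pdeg (A B : nat) (f : {rmorphism {mpoly K[A]} -> {mpoly K[B]}}) :
    (forall p d, p \is d.-homog -> f p \is d.-homog) ->
    forall k p, poly_deg k p -> poly_deg k (f p).
  by move=> hf [d|d] p /=; [apply: hf | move=> ->; rewrite rmorph0].
case: (@homog_vector_primitive K _ r e k (fun j => pi (g j))).
- by move=> j; apply: pdeg.
- by exists j0; apply/eqP => /ker.
move=> k0 [u [h [hu h0 eg prim]]]; exists k0, (fun j => iota (u j)), (iota h).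
have [j1 u1] : exists j, u j != 0.
  exists j0; apply/eqP => e1; apply: g0; apply/ker.
  by rewrite eg e1 mulr0.
split.
- by move=> j; apply: pdeg.
- by move/ker; rewrite iK => /eqP; rewrite (negPf h0).
- by exists j1 => /ker; rewrite iK => /eqP; rewrite (negPf u1).
- by move=> j; apply/ker; rewrite rmorphB rmorphM !iK eg subrr.
move=> v hv.
have hv' i j : pi (v i) * u j = pi (v j) * u i.
  have /ker := hv i j; rewrite rmorphB !rmorphM !iK => /eqP.
  by rewrite subr_eq0 => /eqP.
have [m hm] := ufd_mpoly u1.
have [j|b hb] := prime_product_parallel (v := fun j => pi (v j)) prim hm (b := pi (v j1)).
  by rewrite mulrC hv'.
by exists (iota b) => j; apply/ker; rewrite rmorphB rmorphM !iK hb subrr.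
Qed.

End Hyperplane.

(** From (B C - q) B = 0 and injectivity B C = q as well, so both products have full rank over the
    fraction field. *)
Lemma free_rank (R : idomainType) r l (B : 'M[R]_(r, l)) (C : 'M[R]_(l, r)) q :
  q != 0 -> C *m B = q%:M -> (forall x : 'rV_r, x *m B = 0 -> x = 0) -> r = l.
Proof.
move=> q0 CB inj.
have BC : B *m C = q%:M.
  apply/row_matrixP => i; apply/eqP; rewrite -subr_eq0 -raddfB /=; apply/eqP.
  apply: inj; rewrite -row_mul mulmxBl -mulmxA CB.
  by rewrite mul_mx_scalar mul_scalar_mx subrr row0.
have rk m (M : 'M[{fraction R}]_m) : M = (tofrac q)%:M -> \rank M = m.
  by move=> ->; rewrite mxrank_unit // unitmxE det_scalar unitrX // unitfE tofrac_eq0.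
have rC : \rank (map_mx (@tofrac R) C *m map_mx (@tofrac R) B) = l.
  by apply: rk; rewrite -map_mxM CB map_scalar_mx.
have rB : \rank (map_mx (@tofrac R) B *m map_mx (@tofrac R) C) = r.
  by apply: rk; rewrite -map_mxM BC map_scalar_mx.
apply/eqP; rewrite eqn_leq -{1}rB -[X in (_ <= X)%N && _]rC.
rewrite -[X in _ && (X <= _)%N]rC -[X in _ && (_ <= X)%N]rB.
apply/andP; split.
  apply: leq_trans (mxrankM_maxl _ _) _; rewrite rC; exact: rank_leq_col.
apply: leq_trans (mxrankM_maxr _ _) _; rewrite rB; exact: rank_leq_row.
Qed.

Section HomogeneousBasis.
Variables (K : fieldType) (l : nat) (M : 'rV[{mpoly K[l]}]_l -> Prop).
Variable q : {mpoly K[l]}.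
Hypothesis q0 : q != 0.
Hypothesis M_q : forall i, M (q *: delta_mx 0 i).
Hypothesis M_homog : forall k w, M w -> M (map_mx (pihomog mdeg k) w).

Lemma det_homog n (T : 'M[{mpoly K[l]}]_n) (e : 'I_n -> nat) :
  (forall i j, T i j \is (e i).-homog) -> \det T \is (\sum_i e i).-homog.
Proof.
move=> hT; apply: rpred_sum => s _.
rewrite -signr_odd; case: odd; rewrite ?expr1 ?expr0 ?mulN1r ?mul1r ?rpredN;
  by elim/big_ind2: _ => [|x x' y y' hx hy|i _] //; [apply: dhomog1 | apply: dhomogM].
Qed.

(* Among the homogeneous components of the elements of any basis, some l of
   them form a basis modulo the irrelevant ideal, hence a basis. *)
Lemma homogeneous_basis : free_module M ->
  exists (T : 'M[{mpoly K[l]}]_l) (e : 'I_l -> nat),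
  [/\ \det T != 0, forall i j, T i j \is (e i).-homog &
      forall w, M w <-> exists c, w = c *m T].
Proof.
case=> r [b [span indep]].
pose B : 'M[{mpoly K[l]}]_(r, l) := \matrix_(i < r) b i.
have spanB w : M w <-> exists c, w = c *m B.
  rewrite span; split=> [[c ->]|[c ->]].
    exists (\row_i c i); rewrite mulmx_sum_row.
    by apply: eq_bigr => i _; rewrite mxE rowK.
  exists (fun i => c 0 i); rewrite mulmx_sum_row.
  by apply: eq_bigr => i _; rewrite rowK.
have injB (x : 'rV_r) : x *m B = 0 -> x = 0.
  move=> h; apply/rowP => i; rewrite mxE; apply: (indep (fun i => x 0 i)).
  by rewrite -[RHS]h [RHS]mulmx_sum_row; apply: eq_bigr => j _; rewrite rowK.
have [C CB] : exists C, C *m B = q%:M.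
  have /fin_all_exists [c hc] i : exists c : 'rV_r, q *: delta_mx 0 i = c *m B.
    by apply/spanB/M_q.
  exists (\matrix_i c i); apply/row_matrixP => i.
  by rewrite row_mul rowK -hc; apply/rowP => j; rewrite !mxE eqxx /= mulr_natr eq_sym.
clearbody B; have erl := free_rank q0 CB injB; subst r.
pose N := (\max_(i < l) \max_(j < l) msize (B i j))%N.
have /fin_all_exists [c hc] (x : 'I_l * 'I_N) :
    exists c : 'rV_l, map_mx (pihomog mdeg x.2) (row x.1 B) = c *m B.
  apply/spanB/M_homog/spanB; exists (delta_mx 0 x.1); by rewrite rowE.
(* The components of a basis vector add up to it, hence their coordinate rows add up to a unit
   row. *)
have sumc i : \sum_(k < N) c (i, k) = delta_mx 0 i.
  apply/eqP; rewrite -subr_eq0; apply/eqP/injB; rewrite mulmxBl mulmx_suml -rowE.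
  have -> : \sum_(k < N) c (i, k) *m B = \sum_(k < N) map_mx (pihomog mdeg k) (row i B).
    by apply: eq_bigr => k _; rewrite -hc.
  apply/rowP => j; rewrite !mxE summxE (eq_bigr (fun k : 'I_N => pihomog mdeg k (B i j))).
    rewrite -pihomog_partitionE ?subrr //.
    apply: leq_trans (leq_bigmax i); exact: (leq_bigmax j).
  by move=> k _; rewrite !mxE.
(* Coordinates of all components modulo the irrelevant ideal. Adding the rows of one basis vector
   gives a unit row, so the rank is full and l of the rows form a basis of K^l. *)
pose A : 'M[K]_(#|{: 'I_l * 'I_N}|, l) :=
  \matrix_(t, j) (c (enum_val t) 0 j)@_0%MM.
have fullA : row_full A.
  apply/row_fullP; exists (\matrix_(i, t) ((enum_val t).1 == i)%:R).
  apply/matrixP => i j; rewrite !mxE.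
  pose F (x : 'I_l * 'I_N) := (x.1 == i)%:R * (c x 0 j)@_0%MM.
  rewrite (eq_bigr (fun t => F (enum_val t))) => [|t _]; last by rewrite !mxE.
  rewrite -(big_enum_val F) (eq_bigr (fun x => F (x.1, x.2))); last by case.
  rewrite -(pair_bigA _ (fun i k => F (i, k))) /= (bigD1 i) //= [X in _ + X]big1 ?addr0.
    rewrite (eq_bigr (fun k => (c (i, k) 0 j)@_0%MM)) => [|k _]; last first.
      by rewrite /F /= eqxx mul1r.
    by rewrite -raddf_sum -summxE sumc mxE eqxx /= -mpolyC_nat mcoeffC eqxx mulr1 eq_sym.
  by move=> i' ne; rewrite big1 // => k _; rewrite /F /= (negPf ne) mul0r.
pose f := fullrankfun fullA.
pose E : 'M[{mpoly K[l]}]_l := \matrix_i c (enum_val (f i)).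
have E0 : (\det E)@_0%MM != 0.
  rewrite -det_map_mx -unitfE -unitmxE.
  have -> : map_mx (mcoeff 0%MM) E = rowsub f A by apply/matrixP => i j; rewrite !mxE.
  exact: fullrowsub_unit.
have detB : \det B != 0.
  apply: contraNneq (expf_neq0 l q0) => h.
  by rewrite -det_scalar -CB det_mulmx h mulr0.
have detE : \det E != 0 by apply: contraNneq E0 => ->; rewrite mcoeff0.
exists (E *m B), (fun i => (enum_val (f i)).2 : nat).
have T_homog i j : (E *m B) i j \is ((enum_val (f i)).2).-homog.
  have : row i (E *m B) 0 j \is ((enum_val (f i)).2).-homog.
    by rewrite row_mul rowK -hc !mxE; apply: pihomogP.
  by rewrite mxE.
have detEB : \det (E *m B) != 0 by rewrite det_mulmx mulf_neq0.
split=> //.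
(* [\det E] divides the homogeneous [\det (E *m B)], so it is homogeneous; its nonzero constant term
   makes it a nonzero constant. *)
have [i [j [hi hj _]]] : exists i j, [/\ \det E \is i.-homog, \det B \is j.-homog
    & (i + j = \sum_i (enum_val (f i)).2)%N].
  by apply: dhomog_factor; rewrite -det_mulmx //; apply: det_homog.
have unitE : E \in unitmx.
  have i0 := dhomog_const hi E0; rewrite i0 in hi.
  rewrite unitmxE (dhomog0_const hi) unfold_in /= /mpoly_unit.
  by rewrite mcoeffC eqxx mulr1 eqxx unitfE.
move=> w; rewrite spanB; split=> [[x ->]|[x ->]]; last by exists (x *m E); rewrite mulmxA.
by exists (x *m invmx E); rewrite mulmxA mulmxKV.
Qed.
End HomogeneousBasis.

(** * Modules generated by a free module and one more element *)

Section PlusOne.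
Variables (K : fieldType) (l : nat).
Local Notation S := {mpoly K[l]}.
Variables (W : lmodType S).

(** With the minus sign, the relation L phi = sum_j u_j y_j becomes the kernel element (u, L). *)
Definition plus_one_map (y : 'I_l -> W) (phi : W) (v : 'rV[S]_(l + 1)) : W :=
  \sum_j v 0 (lshift 1 j) *: y j - v 0 (rshift l 0) *: phi.

Fact plus_one_map_is_linear y phi : linear (plus_one_map y phi).
Proof.
move=> c v w; rewrite /plus_one_map scalerBr scaler_sumr scalerA.
rewrite addrACA -opprD; congr (_ - _); last by rewrite !mxE scalerDl.
by rewrite -big_split; apply: eq_bigr => j _; rewrite !mxE scalerDl scalerA.
Qed.

HB.instance Definition _ y phi :=
  GRing.isLinear.Build S 'rV[S]_(l + 1) W _ (plus_one_map y phi)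
    (plus_one_map_is_linear y phi).

Variables (deg : int -> W -> Prop) (M : W -> Prop).
Hypothesis degD : forall k w w', deg k w -> deg k w' -> deg k (w + w').
Hypothesis degZ : forall j k p w, poly_deg j p -> deg k w -> deg (j + k) (p *: w).
Variables (y : 'I_l -> W) (e : 'I_l -> int).
Hypothesis deg_y : forall j, deg (e j) (y j).
Hypothesis indep : forall c : 'I_l -> S, \sum_j c j *: y j = 0 -> forall j, c j = 0.
Variables (a : 'Hom('rV[K]_l, K^o)) (phi : W) (k : int) (u : 'I_l -> S).
Hypothesis a0 : a != 0.
Hypothesis L_phi : lin_poly a *: phi = \sum_j u j *: y j.
Hypothesis deg_phi : deg (k - 1) phi.
Hypothesis deg_u : forall j, poly_deg (k - e j) (u j).
Hypothesis M_gen : forall w, M w <->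
  exists c b, w = \sum_j c j *: y j + b *: phi.

Lemma plus_one_relation c b : \sum_j c j *: y j = b *: phi ->
  forall j, lin_poly a * c j = b * u j.
Proof.
move=> h j; apply/eqP; rewrite -subr_eq0; apply/eqP; move: j; apply: indep.
under eq_bigr do rewrite scalerBl -!scalerA.
rewrite sumrB -!scaler_sumr h -L_phi !scalerA mulrC subrr //.
Qed.

(** Homogeneity makes u_i a nonzero constant, so the relation expresses y_i through phi and the
    other y_j, and phi replaces y_i in the basis. *)
Lemma plus_one_free i : (u i)@_0%MM != 0 -> free_module M.
Proof.
move=> ui0.
have [d ed hd] : exists2 d : nat, k - e i = d & u i \is d.-homog.
  by apply: poly_deg_nat (deg_u i) _; apply: contraNneq ui0 => ->; rewrite mcoeff0.
have d0 := dhomog_const hd ui0; rewrite d0 in hd.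
have ui := dhomog0_const hd; set c0 := (u i)@_0%MM in ui0 ui.
pose bs j := if j == i then phi else y j.
have bsE c : \sum_j c j *: bs j = \sum_j (if j == i then 0 else c j) *: y j + c i *: phi.
  rewrite (bigD1 i) //= /bs eqxx addrC; congr (_ + _).
  rewrite [RHS](bigD1 i) //= eqxx scale0r add0r.
  by apply: eq_bigr => j /negPf ->.
exists l, bs; split=> [w|c].
  rewrite M_gen; split=> [[c [b ->]]|[c ->]]; last first.
    by eexists; eexists; apply: bsE.
  pose t := c i * c0^-1%:MP.
  exists (fun j => if j == i then b + t * lin_poly a else c j - t * u j).
  rewrite bsE eqxx (scalerDl _ b) -scalerA L_phi addrCA [RHS]addrC; congr (_ + _).
  rewrite scaler_sumr -big_split; apply: eq_bigr => j _ /=.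
  rewrite scalerA -scalerDl; congr (_ *: _); case: eqP => [->|_]; last by rewrite subrK.
  by rewrite add0r /t ui -mulrA -mpolyCM mulVf // mulr1.
rewrite bsE => h.
have rel := @plus_one_relation (fun j => if j == i then 0 else c j) (- c i).
have {}rel : forall j, lin_poly a * (if j == i then 0 else c j) = - c i * u j.
  by apply: rel; apply/eqP; rewrite scaleNr -addr_eq0 h.
have ci : c i = 0.
  have /esym/eqP := rel i; rewrite eqxx mulr0 mulNr oppr_eq0 mulf_eq0 => /orP[/eqP//|].
  by rewrite ui mpolyC_eq0 (negPf ui0).
move=> j; have [->//|ne] := eqVneq j i.
have /eqP := rel j; rewrite (negPf ne) ci oppr0 mul0r mulf_eq0.
by rewrite (negPf (lin_poly_neq0 a0)) => /eqP.
Qed.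

(** A relation (v, v') satisfies L v_j = v' u_j for all j. As L is prime and misses some u_j, it
    divides v', and the relation is a multiple of (u, L). *)
Lemma plus_one_SPOG : (forall j, (u j)@_0%MM = 0) -> (exists j, ~ divides (lin_poly a) (u j)) ->
  (forall x z, divides (lin_poly a) (x * z) -> divides (lin_poly a) x \/ divides (lin_poly a) z) ->
  SPOG_module deg M.
Proof.
move=> u0 [j1 uj1] Lprime.
have L0 := lin_poly_neq0 a0.
have deg0 m : deg m 0.
  rewrite -(scale0r phi) -[m](subrK (k - 1)); apply: degZ => //; exact: poly_deg0.
(* The generator phi of degree k - 1 spans S[1-k], y_j spans S[-e_j], and the relation, of degree k,
   spans S[-k]. *)
exists (1 - k), (fun j => - e j), (\row_j u j), a, (plus_one_map y phi).
split=> //.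
have lE j : split (lshift 1 j) = inl j := unsplitK (inl _ j).
have rE : split (rshift l (0 : 'I_1)) = inr 0 := unsplitK (inr _ 0).
pose B : 'M[S]_(1, l + 1) := row_mx (\row_j u j) (lin_poly a)%:M.
have Bl j : B 0 (lshift 1 j) = u j by rewrite row_mxEl mxE.
have Br : B 0 (rshift l 0) = lin_poly a by rewrite row_mxEr mxE eqxx.
have vB (v : 'rV_1) i : (v *m B) 0 i = v 0 0 * B 0 i by rewrite mxE big_ord1.
rewrite -/B; clearbody B.
have ord_case (P : 'I_(l + 1) -> Prop) : (forall j, P (lshift 1 j)) -> P (rshift l 0) ->
    forall i, P i.
  move=> hl hr i; case: (splitP i) => j e1; first by rewrite (_ : i = lshift 1 j) //; apply: val_inj.
  by rewrite (_ : i = rshift l 0) //; apply: val_inj; rewrite /= e1 [j]ord1.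
split; [|split; [|split; [|split; [|split]]]].
- move=> m v hv; apply: ord_case => [j|]; rewrite /= vB ?lE ?rE ?Bl ?Br.
    have -> : - e j + m = (1 - k - 1 + m) + (k - e j) by ring.
    by apply: poly_degM => //; apply: hv.
  have -> : 1 - k + m = (1 - k - 1 + m) + 1 by ring.
  by apply: poly_degM; [apply: hv | apply: lin_poly_homog].
- move=> m v hv; rewrite /= /plus_one_map; apply: degD.
    elim/big_ind: _ => [||j _]; [exact: deg0 | exact: degD |].
    have -> : m = (- e j + m) + e j by ring.
    by apply: degZ => //; have := hv (lshift 1 j); rewrite lE.
  rewrite -scaleNr; have -> : m = (1 - k + m) + (k - 1) by ring.
  apply: degZ => //; have := hv (rshift l 0); rewrite rE -[- v _ _]add0r => h.
  by apply: poly_degB => //; apply: poly_deg0.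
- move=> v v' /rowP /(_ (rshift l 0)); rewrite !vB Br => /(mulIf L0) h.
  by apply/rowP => i; rewrite [i]ord1.
- move=> v; split=> [/eqP|[w ->]].
    rewrite /= /plus_one_map subr_eq0 => /eqP /plus_one_relation rel.
    have [//|[t et]] : divides (lin_poly a) (u j1) \/ divides (lin_poly a) (v 0 (rshift l 0)).
      apply: Lprime; exists (v 0 (lshift 1 j1)); by rewrite mulrC -rel.
    exists t%:M; apply/rowP; apply: ord_case => [j|]; rewrite vB ?Bl ?Br mxE eqxx mulr1n.
      by apply: (mulfI L0); rewrite rel et mulrA.
    by rewrite et mulrC.
  rewrite /= /plus_one_map vB Br -scalerA L_phi scaler_sumr -sumrB big1 // => j _.
  by rewrite vB Bl scalerA subrr.
- move=> w; rewrite M_gen; split=> [[c [b ->]]|[v ->]].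
    exists (row_mx (\row_j c j) (- b)%:M); rewrite /= /plus_one_map row_mxEr mxE eqxx.
    rewrite mulr1n scaleNr opprK; congr (_ + _); apply: eq_bigr => j _.
    by rewrite row_mxEl mxE.
  exists (fun j => v 0 (lshift 1 j)), (- v 0 (rshift l 0)).
  by rewrite /= /plus_one_map scaleNr.
- move=> i; rewrite [i]ord1; apply: ord_case => [j|]; rewrite ?Bl ?Br //.
  apply/eqP/negPn/negP => /(dhomog_const (lin_poly_homog a)) //.
Qed.

End PlusOne.

(** * Deletion *)

Lemma free_module_ext (K : fieldType) l (W : lmodType {mpoly K[l]}) (M N : W -> Prop) :
  (forall w, M w <-> N w) -> free_module M -> free_module N.
Proof.
by move=> h [r [b [hs hi]]]; exists r, b; split=> // w; rewrite -h.
Qed.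

Section LinPolyPower.
Variables (K : fieldType) (l : nat) (a : 'Hom('rV[K]_l, K^o)).
Hypothesis a0 : a != 0.

Lemma divides_lin_polyX_cancel k b x : ~ divides (lin_poly a) b ->
  divides (lin_poly a ^+ k) (b * x) -> divides (lin_poly a ^+ k) x.
Proof.
move=> hb; elim: k => [|k IH]; first by exists x; rewrite expr0 mul1r.
move=> [c e]; have [|x' ex] := IH.
  by exists (lin_poly a * c); rewrite e exprSr mulrA.
have : divides (lin_poly a) (b * x').
  exists c; apply: (mulfI (expf_neq0 k (lin_poly_neq0 a0))).
  by rewrite mulrCA -ex e exprSr mulrA.
case/(lin_poly_prime a0) => // -[x2 e2]; exists x2.
by rewrite ex e2 exprSr mulrA.
Qed.

End LinPolyPower.

(** * Logarithmic derivations *)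

Section Dmod.
Variables (K : fieldType) (l : nat).
Local Notation S := {mpoly K[l]}.
Implicit Types (theta : 'rV[S]_l) (b : 'Hom('rV[K]_l, K^o)).

Lemma der_applyE theta b :
  der_apply theta (lin_poly b) = \sum_i theta 0 i * (b (delta_mx 0 i) : K)%:MP.
Proof. by apply: eq_bigr => i _; rewrite mderiv_lin_poly. Qed.

Lemma der_applyD theta theta' p :
  der_apply (theta + theta') p = der_apply theta p + der_apply theta' p.
Proof. by rewrite -big_split; apply: eq_bigr => i _; rewrite mxE mulrDl. Qed.

Lemma der_applyZ c theta p : der_apply (c *: theta) p = c * der_apply theta p.
Proof. by rewrite [RHS]mulr_sumr; apply: eq_bigr => i _; rewrite mxE mulrA. Qed.

Lemma der_apply_mulmx r (c : 'rV[S]_r) (T : 'M[S]_(r, l)) p :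
  der_apply (c *m T) p = \sum_j c 0 j * der_apply (row j T) p.
Proof.
rewrite mulmx_sum_row; elim/big_rec2: _ => [|j x y _ <-].
  by rewrite /der_apply big1 // => i _; rewrite mxE mul0r.
by rewrite der_applyD der_applyZ.
Qed.

Lemma der_apply_delta i b :
  der_apply (delta_mx 0 i) (lin_poly b) = (b (delta_mx 0 i) : K)%:MP.
Proof.
rewrite der_applyE (bigD1 i) //= mxE !eqxx mul1r big1 ?addr0 // => j ne.
by rewrite mxE (negPf ne) andbF mul0r.
Qed.

Lemma der_apply_homog k theta b : der_deg k theta -> poly_deg k (der_apply theta (lin_poly b)).
Proof.
move=> h; rewrite der_applyE; apply: poly_deg_sum => i.
rewrite -[k]addr0; apply: poly_degM => //=.
by rewrite -[_%:MP]mulr1 mul_mpolyC; apply/dhomogZ/dhomog1.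
Qed.

Lemma der_degD k theta theta' :
  der_deg k theta -> der_deg k theta' -> der_deg k (theta + theta').
Proof. by move=> h h' i; rewrite mxE; apply: poly_degD. Qed.

Lemma der_degZ j k p theta :
  poly_deg j p -> der_deg k theta -> der_deg (j + k) (p *: theta).
Proof. by move=> h h' i; rewrite mxE; apply: poly_degM. Qed.

Lemma row_mulmx_inj n (T : 'M[S]_n) : \det T != 0 ->
  forall x y : 'rV_n, x *m T = y *m T -> x = y.
Proof.
move=> d0 x y /(congr1 (fun z => z *m \adj T)).
rewrite -!mulmxA mul_mx_adj !mul_mx_scalar => /rowP h.
by apply/rowP => i; have := h i; rewrite !mxE => /(mulfI d0).
Qed.

Variables (A : {fset {vspace 'rV[K]_l}}) (alpha : A -> 'Hom('rV[K]_l, K^o)).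
Implicit Types (m : A -> nat).

Lemma DmodP m theta : Dmod alpha m theta <->
  forall H, divides (lin_poly (alpha H) ^+ m H) (der_apply theta (lin_poly (alpha H))).
Proof.
by split=> h H; have [g e] := h H; exists g; rewrite e mulrC.
Qed.

Lemma DmodD m theta theta' : Dmod alpha m theta -> Dmod alpha m theta' ->
  Dmod alpha m (theta + theta').
Proof.
by move=> /DmodP h /DmodP h'; apply/DmodP => H; rewrite der_applyD; apply: dividesD.
Qed.

Lemma DmodZ m c theta : Dmod alpha m theta -> Dmod alpha m (c *: theta).
Proof.
by move=> /DmodP h; apply/DmodP => H; rewrite der_applyZ; apply: divides_mull.
Qed.

Lemma Dmod_sum m (I : finType) (F : I -> 'rV[S]_l) :
  (forall i, Dmod alpha m (F i)) -> Dmod alpha m (\sum_i F i).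
Proof.
move=> h; elim/big_ind: _ => // [|x y]; last exact: DmodD.
by move=> H; exists 0; rewrite mul0r /der_apply big1 // => i _; rewrite mxE mul0r.
Qed.

(** Evaluation at a linear form has constant coefficients, so it commutes with taking homogeneous
    components. *)
Lemma Dmod_homog m k theta : Dmod alpha m theta ->
  Dmod alpha m (map_mx (pihomog mdeg k) theta).
Proof.
move=> h H; have [g e] := h H.
have -> : der_apply (map_mx (pihomog mdeg k) theta) (lin_poly (alpha H))
          = pihomog mdeg k (der_apply theta (lin_poly (alpha H))).
  rewrite !der_applyE raddf_sum; apply: eq_bigr => i _.
  by rewrite mxE /= ![_ * _%:MP]mulrC !mul_mpolyC linearZ.
have hL := dhomogMn (m H) (lin_poly_homog (alpha H)).
rewrite e (pihomogM_homog k g hL); case: ifP => _; last by exists 0; rewrite mul0r.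
by eexists.
Qed.

Lemma divides_Qpoly m H : divides (lin_poly (alpha H) ^+ m H) (Qpoly alpha m).
Proof. by rewrite /Qpoly (bigD1 H) //=; eexists. Qed.

Lemma Dmod_Qpoly m theta : Dmod alpha m (Qpoly alpha m *: theta).
Proof.
by apply/DmodP => H; rewrite der_applyZ; apply/divides_mulr/divides_Qpoly.
Qed.

Lemma row_poly_sum k n (c : 'I_k -> S) (T : 'M[S]_(k, n)) :
  \sum_j c j *: row j T = (\row_j c j) *m T.
Proof. by rewrite mulmx_sum_row; apply: eq_bigr => j _; rewrite mxE. Qed.

End Dmod.

Section Arrangement.
Variables (K : fieldType) (l : nat).
Local Notation S := {mpoly K[l]}.
Variables (A : {fset {vspace 'rV[K]_l}}) (alpha : A -> 'Hom('rV[K]_l, K^o)).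
Hypotheses (hA : is_arrangement A) (halpha : is_defining alpha).

Lemma alpha_neq0 H : alpha H != 0.
Proof.
apply/eqP => e; have := hA H; rewrite -(halpha H) e.
have -> : lker (0 : 'Hom('rV[K]_l, K^o)) = fullv.
  by apply/vspaceP => v; rewrite memv_ker lfunE eqxx memvf.
by rewrite dimvf /dim /= mul1n => /eqP; rewrite eqn_leq ltnn.
Qed.

Lemma alpha_coprime H H' : H' != H -> ~ divides (lin_poly (alpha H)) (lin_poly (alpha H')).
Proof.
move=> ne /(lin_poly_divides (alpha_neq0 H)) [c e]; case/eqP: ne; apply: val_inj.
rewrite -(halpha H) -(halpha H'); apply/vspaceP => v; rewrite !memv_ker e lfunE /=.
rewrite scaler_eq0; case: eqP => // c0.
by have := alpha_neq0 H'; rewrite e c0 scale0r eqxx.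
Qed.

Lemma Qpoly_neq0 m : Qpoly alpha m != 0.
Proof. by apply/prodf_neq0 => H _; apply/expf_neq0/lin_poly_neq0/alpha_neq0. Qed.

Lemma Dmod_homogeneous_basis m : multi_free alpha m ->
  exists (T : 'M[S]_l) (e : 'I_l -> nat),
  [/\ \det T != 0, forall i j, T i j \is (e i).-homog &
      forall w, Dmod alpha m w <-> exists c, w = c *m T].
Proof.
apply: (homogeneous_basis (Qpoly_neq0 m)).
  by move=> i; apply: Dmod_Qpoly.
by move=> k w; apply: Dmod_homog.
Qed.

Variables (m m' : A -> nat) (H : A).
Hypothesis m'_neq : forall H', H' != H -> m' H' = m H'.
Hypothesis m'_H : m H = (m' H).+1.
Local Notation L := (lin_poly (alpha H)).

Lemma Dmod_sub theta : Dmod alpha m theta -> Dmod alpha m' theta.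
Proof.
move=> /DmodP h; apply/DmodP => H'; have [->|ne] := eqVneq H' H; last by rewrite m'_neq.
by have [c ->] := h H; rewrite m'_H exprSr -mulrA; eexists.
Qed.

Lemma Dmod_step theta g : Dmod alpha m' theta ->
  der_apply theta L = L ^+ m' H * g -> Dmod alpha m theta <-> divides L g.
Proof.
move=> /DmodP h e; split=> [/DmodP/(_ H)|[c ec]].
  rewrite e m'_H exprSr => -[c ec]; exists c.
  by apply: (mulfI (expf_neq0 (m' H) (lin_poly_neq0 (alpha_neq0 H)))); rewrite ec mulrA.
apply/DmodP => H'; have [->|ne] := eqVneq H' H; last by rewrite -m'_neq.
by rewrite e ec m'_H exprSr mulrA; eexists.
Qed.

Lemma Dmod_scale theta : Dmod alpha m' theta -> Dmod alpha m (L *: theta).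
Proof.
move=> h; have /DmodP/(_ H) [g e] := h.
apply/(Dmod_step (g := L * g)); first exact: DmodZ.
  by rewrite der_applyZ e mulrCA.
by eexists.
Qed.

Lemma Dmod_unscale theta : Dmod alpha m (L *: theta) -> Dmod alpha m' theta.
Proof.
move=> /DmodP h; apply/DmodP => H'; have := h H'; rewrite der_applyZ.
have [->|ne] := eqVneq H' H.
  rewrite m'_H exprS => -[c]; rewrite -mulrA => /(mulfI (lin_poly_neq0 (alpha_neq0 H))) ->.
  by exists c.
rewrite m'_neq //; apply: divides_lin_polyX_cancel; first exact: alpha_neq0.
by apply: alpha_coprime; rewrite eq_sym.
Qed.

Theorem deletion : multi_free alpha m -> multi_free alpha m' \/ multi_SPOG alpha m'.
Proof.
move=> Mfree; have [T [e [detT T_homog spanT]]] := Dmod_homogeneous_basis Mfree.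
have a0 := alpha_neq0 H; have L0 := lin_poly_neq0 a0.
have Tinj := row_mulmx_inj detT.
(* Coordinates of the elements of L D(A,m'), a submodule of D(A,m). *)
pose U (u : 'rV[S]_l) := exists y, u *m T = L *: y.
have U_Dmod u y : u *m T = L *: y -> Dmod alpha m' y.
  by move=> h; apply: Dmod_unscale; rewrite -h; apply/spanT; exists u.
have divL (u : 'rV[S]_l) : (forall j, divides L (u 0 j)) -> exists w : 'rV_l, u = L *: w.
  move=> /fin_all_exists [w hw]; exists (\row_j w j).
  by apply/rowP => j; rewrite !mxE hw.
have [Utriv|] := classic (forall u, U u -> forall j, divides L (u 0 j)).
  left; apply: free_module_ext Mfree => w; split; first exact: Dmod_sub.
  move=> /Dmod_scale /spanT [u hu].
  have [|u' eu] := divL u; first by apply: Utriv; exists w.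
  apply/spanT; exists u'; apply/rowP => j; apply: (mulfI L0).
  by have /rowP/(_ j) := hu; rewrite eu -scalemxAl !mxE.
(* U is graded, so it has a homogeneous element not divisible by L. *)
move=> /not_all_ex_not [u1 hu1]; have [[z1 hz1] nd] := imply_to_and _ _ hu1.
have [k [g [[z hz] g_homog g_nd]]] : exists (k : nat) (g : 'rV[S]_l),
    [/\ U g, forall j, poly_deg (k%:Z - (e j)%:Z) (g 0 j) & ~ forall j, divides L (g 0 j)].
  (* Component of degree k when the j-th basis vector has degree [e j]; the test guards the
     truncated subtraction. *)
  pose comp (k : nat) : 'rV[S]_l :=
    \row_j if (e j <= k)%N then pihomog mdeg (k - e j) (u1 0 j) else 0.
  have compU k : U (comp k).
    have : forall i, divides L ((comp k *m T) 0 i).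
      move=> i; have -> : (comp k *m T) 0 i = pihomog mdeg k (z1 0 i * L).
        have /rowP/(_ i) := hz1; rewrite !mxE => e1; rewrite mulrC -e1 raddf_sum.
        apply: eq_bigr => j _; rewrite mxE /= (pihomogM_homog _ _ (T_homog j i)).
        by case: ifP; rewrite ?mul0r.
      rewrite (pihomogM_homog _ _ (lin_poly_homog _)); case: ifP => _.
        by eexists; rewrite mulrC.
      by exists 0; rewrite mulr0.
    by move/divL => [y hy]; exists y.
  have comp_homog k j : poly_deg (k%:Z - (e j)%:Z) (comp k 0 j).
    rewrite mxE; case: leqP => h; last exact: poly_deg0.
    by rewrite subzn //; apply: pihomogP.
  have [Hd|/not_all_ex_not [k hk]] := classic (forall k j, divides L (comp k 0 j)); last first.
    by exists k, (comp k).
  case: nd => j; rewrite (pihomog_partitionE (leqnn (mmeasure mdeg (u1 0 j)))).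
  by apply: divides_sum => d; have := Hd (d + e j)%N j; rewrite mxE leq_addl addnK.
have z_Dmod := U_Dmod _ _ hz.
have /DmodP/(_ H) [x hx] := z_Dmod.
(* Otherwise z would lie in D(A,m), and g would be L times its coordinates. *)
have x_nd : ~ divides L x.
  move=> /(Dmod_step z_Dmod hx) /spanT [w hw]; apply: g_nd => j.
  have -> : g = L *: w by apply: Tinj; rewrite hz hw scalemxAl.
  by rewrite mxE; eexists.
(* y x' - x y' lies in D(A,m), where x L^(m'(H)) and x' L^(m'(H)) are the
   values at L of the elements y and y' attached to g and v: U has rank one. *)
have par v : U v -> forall i j, divides L (v 0 i * g 0 j - v 0 j * g 0 i).
  move=> [y hy] i j; have y_Dmod := U_Dmod _ _ hy.
  have /DmodP/(_ H) [t ht] := y_Dmod.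
  have : Dmod alpha m (x *: y - t *: z).
    apply/(Dmod_step (g := 0)); last by exists 0; rewrite mulr0.
      by rewrite -scaleN1r; apply: DmodD; rewrite ?scalerA; apply: DmodZ.
    rewrite -scaleNr der_applyD !der_applyZ hx ht; ring.
  move=> /spanT [w hw].
  have ew : x *: v - t *: g = L *: w.
    apply: Tinj; rewrite mulmxBl -!scalemxAl hy hz -hw scalerBr !scalerA.
    by rewrite [x * L]mulrC [t * L]mulrC.
  have ew' i' : x * v 0 i' = L * w 0 i' + t * g 0 i'.
    by have /rowP/(_ i') := ew; rewrite !mxE => <-; rewrite subrK.
  have : divides L (x * (v 0 i * g 0 j - v 0 j * g 0 i)).
    rewrite mulrBr !mulrA !ew'; exists (w 0 i * g 0 j - w 0 j * g 0 i); ring.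
  by case/(lin_poly_prime a0).
have [k0 [u [h [u_homog h_nd u_nd gu prim]]]] :=
  primitive_part a0 (e := fun j => (e j)%:Z) (g := fun j => g 0 j) g_homog g_nd.
(* Modulo L, h times u T is g T, which vanishes; the prime L does not divide h. *)
have [phi hphi] : U (\row_j u j).
  have : forall i, divides L (((\row_j u j) *m T) 0 i).
    move=> i; have : divides L (h * ((\row_j u j) *m T) 0 i).
      have -> : h * ((\row_j u j) *m T) 0 i = (g *m T) 0 i - \sum_j (g 0 j - h * u j) * T j i.
        rewrite !mxE mulr_sumr -sumrB; apply: eq_bigr => j _; rewrite mxE; ring.
      apply: dividesB; first by rewrite hz mxE; eexists.
      by apply: divides_sum => j; apply: divides_mulr.
    by case/(lin_poly_prime a0).
  by move/divL => [y hy]; exists y.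
have U_gen v : U v -> exists b c, v = b *: (\row_j u j) + L *: c.
  move=> /par hv; case: (prim (fun j => v 0 j)) => [i j|b hb].
    have : divides L (h * (v 0 i * u j - v 0 j * u i)).
      have -> : h * (v 0 i * u j - v 0 j * u i) = (v 0 i * g 0 j - v 0 j * g 0 i)
          + (v 0 j * (g 0 i - h * u i) - v 0 i * (g 0 j - h * u j)) by ring.
      apply: dividesD => //; apply: dividesB; exact: divides_mull.
    by case/(lin_poly_prime a0).
  have [|c hc] := divL (v - b *: \row_j u j); first by move=> j; rewrite !mxE.
  by exists b, c; rewrite -hc addrC subrK.
have M_gen w : Dmod alpha m' w <-> exists c b, w = \sum_j c j *: row j T + b *: phi.
  split=> [/Dmod_scale /spanT [v hv]|[c [b ->]]]; last first.
    apply: DmodD; last by apply/DmodZ/U_Dmod/hphi.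
    apply: Dmod_sum => j; apply/DmodZ/Dmod_sub/spanT; exists (delta_mx 0 j).
    by rewrite rowE.
  have [|b [c ev]] := U_gen v; first by exists w.
  exists (fun j => c 0 j), b; rewrite row_poly_sum.
  apply/rowP => i; apply: (mulfI L0).
  have /rowP/(_ i) := hv; rewrite ev mulmxDl -!scalemxAl hphi !mxE => ->.
  rewrite mulrDr [RHS]addrC mulrCA; congr (_ + L * _).
  by apply: eq_bigr => j _; rewrite mxE.
have deg_T j : der_deg (e j)%:Z (row j T) by move=> i; rewrite mxE; apply: T_homog.
have indep (c : 'I_l -> S) : \sum_j c j *: row j T = 0 -> forall j, c j = 0.
  rewrite row_poly_sum => h0 j.
  have /rowP/(_ j) : \row_j c j = 0 by apply: Tinj; rewrite h0 mul0mx.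
  by rewrite !mxE.
have L_phi : L *: phi = \sum_j u j *: row j T by rewrite row_poly_sum hphi.
have deg_phi : der_deg (k0 - 1) phi.
  move=> i; apply: (poly_deg_divl (lin_poly_homog (alpha H)) L0).
  have -> : L * phi 0 i = \sum_j u j * T j i.
    have /rowP/(_ i) := L_phi; rewrite mxE => ->; rewrite summxE.
    by apply: eq_bigr => j _; rewrite !mxE.
  apply: poly_deg_sum => j; rewrite -[k0](subrK (e j)%:Z).
  by apply: poly_degM => //; apply: T_homog.
have [u0|/not_all_ex_not [i /eqP ui]] := classic (forall j, (u j)@_0%MM = 0).
  right; apply: (plus_one_SPOG (@der_degD K l) (@der_degZ K l) deg_T indep
    a0 L_phi deg_phi u_homog M_gen u0 u_nd).
  exact: lin_poly_prime.
left; exact: (plus_one_free indep a0 L_phi u_homog M_gen ui).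
Qed.
End Arrangement.

(** * Rational forms and duality *)

Section Forms.
Variables (K : fieldType) (l : nat).
Local Notation S := {mpoly K[l]}.
Local Notation F := {fraction S}.
Local Notation frac := (@tofrac S).
Implicit Types (w : ratform K l) (theta : 'rV[S]_l).

Definition pairing w theta : F := \sum_i ratcoef w i * frac (theta 0 i).

Lemma ratcoefD w w' i : ratcoef (w + w') i = ratcoef w i + ratcoef w' i.
Proof. by rewrite /ratcoef !mxE. Qed.

Lemma ratcoefZ c w i : ratcoef (c *: w) i = frac c * ratcoef w i.
Proof. by rewrite /ratcoef !mxE. Qed.

Lemma pairingD w w' theta : pairing (w + w') theta = pairing w theta + pairing w' theta.
Proof. by rewrite -big_split; apply: eq_bigr => i _; rewrite ratcoefD mulrDl. Qed.

Lemma pairingZ c w theta : pairing (c *: w) theta = frac c * pairing w theta.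
Proof. by rewrite [RHS]mulr_sumr; apply: eq_bigr => i _; rewrite ratcoefZ mulrA. Qed.

Lemma pairing_sum (I : finType) (w : I -> ratform K l) theta :
  pairing (\sum_i w i) theta = \sum_i pairing (w i) theta.
Proof.
elim/big_rec2: _ => [|i x y _ <-]; last by rewrite pairingD.
by rewrite /pairing big1 // => i _; rewrite /ratcoef mxE mul0r.
Qed.

Lemma pairing_mulmx w r (c : 'rV[S]_r) (T : 'M[S]_(r, l)) :
  pairing w (c *m T) = \sum_j frac (c 0 j) * pairing w (row j T).
Proof.
under [RHS]eq_bigr do rewrite mulr_sumr.
rewrite exchange_big; apply: eq_bigr => i _ /=.
rewrite mxE rmorph_sum mulr_sumr; apply: eq_bigr => j _.
by rewrite rmorphM mxE /= mulrCA.
Qed.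

Lemma pairingZr w (c : S) theta : pairing w (c *: theta) = frac c * pairing w theta.
Proof.
by rewrite [RHS]mulr_sumr; apply: eq_bigr => i _; rewrite mxE rmorphM /= mulrCA.
Qed.

Lemma pairing_delta w i : pairing w (delta_mx 0 i) = ratcoef w i.
Proof.
rewrite /pairing (bigD1 i) //= mxE !eqxx rmorph1 mulr1 big1 ?addr0 // => j ne.
by rewrite mxE (negPf ne) andbF rmorph0 mulr0.
Qed.

Lemma frac_degD k x y : frac_deg k x -> frac_deg k y -> frac_deg k (x + y : F).
Proof.
move=> [p [q [d [d' [hp hq q0 ex ek]]]]] [p' [q' [c [c' [hp' hq' q0' ey ek']]]]].
exists (p * q' + p' * q), (q * q'), (d + c')%N, (d' + c')%N; split.
- apply: dhomogD; first exact: dhomogM.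
  have -> : (d + c' = c + d')%N by lia.
  exact: dhomogM.
- exact: dhomogM.
- by rewrite mulf_neq0.
- by rewrite ex ey addf_div ?tofrac_eq0 // rmorphD !rmorphM.
- lia.
Qed.

Lemma form_degD k w w' : form_deg k w -> form_deg k w' -> form_deg k (w + w').
Proof. by move=> h h' i; rewrite ratcoefD; apply: frac_degD. Qed.

Variables (a : 'Hom('rV[K]_l, K^o)).
Hypothesis a0 : a != 0.
Local Notation L := (lin_poly a).

(** In negative degree, zero needs a nonzero homogeneous denominator of positive degree; a power of
    L provides it. *)
Lemma frac_deg0 k : frac_deg k (0 : F).
Proof.
case: k => n.
  exists 0, 1, n, 0%N; rewrite dhomog0 dhomog1 oner_eq0 rmorph0 mul0r subr0; split=> //.
exists 0, (L ^+ n.+1), 0%N, (1 * n.+1)%N; rewrite dhomog0 dhomogMn ?lin_poly_homog //.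
by rewrite expf_neq0 ?lin_poly_neq0 // rmorph0 mul0r mul1n sub0r NegzE; split.
Qed.

Lemma frac_deg_scale j k p x : poly_deg j p -> frac_deg k x -> frac_deg (j + k) (frac p * x).
Proof.
case: j => [j|j] /=; last by move=> ->; rewrite rmorph0 mul0r => _; apply: frac_deg0.
move=> hp [p' [q [d [d' [hp' hq q0 -> ->]]]]].
exists (p * p'), q, (j + d)%N, d'; split=> //; first exact: dhomogM.
  by rewrite mulrA -rmorphM.
by rewrite PoszD addrA.
Qed.

Lemma frac_deg_div k x : frac_deg k x -> frac_deg (k - 1) ((frac L)^-1 * x).
Proof.
move=> [p [q [d [d' [hp hq q0 -> ->]]]]].
exists p, (q * L), d, (d' + 1)%N; split=> //.
- exact/dhomogM/lin_poly_homog.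
- by rewrite mulf_neq0 ?lin_poly_neq0.
- by rewrite rmorphM invfM [RHS]mulrA [RHS]mulrC.
- lia.
Qed.

Lemma form_degZ j k p w : poly_deg j p -> form_deg k w -> form_deg (j + k) (p *: w).
Proof. by move=> h h' i; rewrite ratcoefZ; apply: frac_deg_scale. Qed.

Lemma form_deg_sum k (I : finType) (w : I -> ratform K l) :
  (forall i, form_deg k (w i)) -> form_deg k (\sum_i w i).
Proof.
move=> h; apply: (big_ind (form_deg k)) => [i|w1 w2|//]; last exact: form_degD.
by rewrite /ratcoef mxE; apply: frac_deg0.
Qed.

End Forms.

(** * The dual basis over the fraction field *)

Section DualBasis.
Variables (K : fieldType) (l : nat).
Local Notation S := {mpoly K[l]}.
Local Notation frac := (@tofrac S).
Variables (T : 'M[S]_l) (e : 'I_l -> nat).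
Hypothesis detT : \det T != 0.
Hypothesis T_homog : forall i j, T i j \is (e i).-homog.

Definition dual_row (j : 'I_l) : ratform K l := row j (invmx (map_mx frac T))^T.

Lemma dual_unit : map_mx frac T \in unitmx.
Proof. by rewrite unitmxE unitfE det_map_mx tofrac_eq0. Qed.

Lemma pairing_dual_row j i : pairing (dual_row j) (row i T) = (i == j)%:R.
Proof.
have /matrixP/(_ i j) := mulmxV dual_unit; rewrite !mxE => <-.
by apply: eq_bigr => k _; rewrite /ratcoef !mxE mulrC.
Qed.

Lemma dual_row_expansion (w : ratform K l) i :
  ratcoef w i = \sum_j pairing w (row j T) * ratcoef (dual_row j) i.
Proof.
under eq_bigr do rewrite mulr_suml.
rewrite exchange_big /= (bigD1 i) //= [X in _ + X]big1 ?addr0 => [|k ne].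
  under eq_bigr do rewrite -mulrA.
  rewrite -mulr_sumr.
  have /matrixP/(_ i i) := mulVmx dual_unit; rewrite !mxE eqxx.
  under eq_bigr do rewrite mxE mulrC.
  under [X in _ * X]eq_bigr do rewrite /ratcoef !mxE.
  by move=> ->; rewrite mulr1.
under eq_bigr do rewrite -mulrA.
rewrite -mulr_sumr.
have /matrixP/(_ i k) := mulVmx dual_unit; rewrite !mxE eq_sym (negPf ne).
under eq_bigr do rewrite mxE mulrC.
under [X in _ * X]eq_bigr do rewrite /ratcoef !mxE.
by move=> ->; rewrite mulr0.
Qed.

(** By Cramer's rule each entry is a cofactor without row j, divided by the determinant. *)
Lemma dual_row_deg j : form_deg (- (e j)%:Z) (dual_row j).
Proof.
move=> i; exists (cofactor T j i), (\det T), (\sum_k e (lift j k))%N, (\sum_i e i)%N.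
split=> //.
- rewrite /cofactor -signr_odd.
  have : \det (row' j (col' i T)) \is (\sum_k e (lift j k)).-homog.
    by apply: det_homog => k k'; rewrite !mxE.
  by case: odd; rewrite ?expr1 ?expr0 ?mulN1r ?mul1r ?rpredN.
- exact: det_homog.
- rewrite /ratcoef !mxE /invmx dual_unit !mxE det_map_mx mulrC.
  by rewrite cofactor_map_mx.
- have -> : (\sum_i e i = e j + \sum_k e (lift j k))%N by rewrite (@bigD1_ord _ _ _ _ j).
  by rewrite PoszD opprD addrCA subrr addr0.
Qed.

Lemma dual_row_indep (c : 'I_l -> S) : \sum_j c j *: dual_row j = 0 -> forall j, c j = 0.
Proof.
move=> h i; have := congr1 (fun w => pairing w (row i T)) h => /=.
rewrite pairing_sum (bigD1 i) //= pairingZ pairing_dual_row eqxx mulr1.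
rewrite big1 ?addr0 => [|j ne]; last first.
  by rewrite pairingZ pairing_dual_row eq_sym (negPf ne) mulr0.
rewrite /pairing [RHS]big1 => [|j _]; last by rewrite /ratcoef mxE mul0r.
by move/eqP; rewrite tofrac_eq0 => /eqP.
Qed.

End DualBasis.

Lemma tofrac_div_cancel (R : idomainType) (x y s : R) (z : {fraction R}) :
  x != 0 -> y != 0 -> tofrac y * z = tofrac s ->
  z = tofrac x / tofrac (x * y) * tofrac s.
Proof.
move=> x0 y0 <-; rewrite tofracM invfM mulVKf ?tofrac_eq0 //.
by rewrite mulKf ?tofrac_eq0.
Qed.

(** * Logarithmic forms as the dual module, and addition *)

Section Duality.
Variables (K : fieldType) (l : nat).
Local Notation S := {mpoly K[l]}.
Local Notation frac := (@tofrac S).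
Variables (A : {fset {vspace 'rV[K]_l}}) (alpha : A -> 'Hom('rV[K]_l, K^o)).
Hypotheses (hA : is_arrangement A) (halpha : is_defining alpha).
Implicit Types (m : A -> nat) (w : ratform K l).

Lemma Qpoly_divides m p :
  (forall H, divides (lin_poly (alpha H) ^+ m H) p) -> divides (Qpoly alpha m) p.
Proof.
move=> h; rewrite /Qpoly; elim: (index_enum _) (index_enum_uniq A) => [|H s IH] /=.
  by rewrite big_nil => _; exists p; rewrite mul1r.
move=> /andP[Hs /IH [t et]]; rewrite big_cons.
have a0 := alpha_neq0 hA halpha H.
have nd : ~ divides (lin_poly (alpha H)) (\prod_(H' <- s) lin_poly (alpha H') ^+ m H').
  elim: (s) Hs => [_|H' s' IH']; first by rewrite big_nil; apply: lin_poly_ndivides1.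
  rewrite inE negb_or big_cons => /andP[ne hs'] /(lin_poly_prime a0) [|]; last exact: IH'.
  by move=> /(lin_poly_primeX a0); apply: (alpha_coprime hA halpha); rewrite eq_sym.
have [|t' et'] := divides_lin_polyX_cancel a0 (k := m H) (x := t) nd; first by rewrite -et.
by exists t'; rewrite et et' mulrCA mulrA.
Qed.

Lemma ratcoef_dform (b : 'Hom('rV[K]_l, K^o)) i :
  ratcoef (dform (lin_poly b)) i = frac (b (delta_mx 0 i) : K)%:MP.
Proof. by rewrite /ratcoef mxE mderiv_lin_poly. Qed.

(** For a logarithmic form eta/Q, contraction shows each power of a defining form to divide the
    pairing of eta with theta, so their product Q does. Conversely, the conditions on w are read off
    from its pairings with explicit elements of D(A,m). *)
Lemma Omega1_dual m w : Omega1 alpha m w <->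
  forall theta, Dmod alpha m theta -> exists s, pairing w theta = frac s.
Proof.
have Q0 : frac (Qpoly alpha m) != 0 by rewrite tofrac_eq0 Qpoly_neq0.
split=> [[/fin_all_exists [eta he] hw] theta /DmodP hD|hw].
  suff [s hs] : divides (Qpoly alpha m) (\sum_i eta i * theta 0 i).
    exists s; have : frac (\sum_i eta i * theta 0 i) = frac (Qpoly alpha m) * frac s.
      by rewrite hs rmorphM.
    rewrite rmorph_sum /pairing => e; apply: (mulfI Q0); rewrite -e mulr_sumr.
    by apply: eq_bigr => i _; rewrite he rmorphM !mulrA mulfV // mul1r.
  apply: Qpoly_divides => H; set L := lin_poly (alpha H).
  have a0 := alpha_neq0 hA halpha H; have [i ai] := Hom_neq0 a0.
  pose b j : S := (alpha H (delta_mx 0 j) : K)%:MP.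
  have wlt (j k : 'I_l) : (j < k)%N -> divides (L ^+ m H) (eta j * b k - eta k * b j).
    move=> /(hw H) [g]; rewrite /wedge !ratcoef_dform !he => e; exists g.
    apply/eqP; rewrite -tofrac_eq rmorphB !rmorphM; apply/eqP.
    apply: (mulfI (invr_neq0 Q0)); rewrite mulrBr !mulrA e.
    by congr (_ * _); apply: mulrC.
  have wall j k : divides (L ^+ m H) (eta j * b k - eta k * b j).
    case: (ltngtP j k) => [/wlt//|/wlt [c e]|/val_inj ->].
      by exists (- c); rewrite mulrN -e opprB.
    by exists 0; rewrite subrr mulr0.
  (* Contract eta /\ dL, which is divisible by L^(m(H)), with theta. *)
  have : divides (L ^+ m H) (b i * \sum_j eta j * theta 0 j).
    have -> : b i * (\sum_j eta j * theta 0 j) =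
        \sum_j theta 0 j * (eta j * b i - eta i * b j) + eta i * \sum_j theta 0 j * b j.
      by rewrite !mulr_sumr -big_split; apply: eq_bigr => j _ /=; ring.
    apply: dividesD.
      by apply: divides_sum => j; apply: divides_mull.
    by apply: divides_mull; have := hD H; rewrite der_applyE.
  move=> [c ec]; exists ((alpha H (delta_mx 0 i) : K)^-1%:MP * c).
  by rewrite mulrCA -ec mulrA -mpolyCM mulVf // mul1r.
split=> [i|H i j ij].
  have [s hs] := hw _ (Dmod_Qpoly alpha m (delta_mx 0 i)); exists s.
  by rewrite -hs pairingZr pairing_delta mulKf.
set L := lin_poly (alpha H).
have L0 : L != 0 := lin_poly_neq0 (alpha_neq0 hA halpha H).
pose b j : S := (alpha H (delta_mx 0 j) : K)%:MP.
have [Q' eQ] := divides_Qpoly alpha m H.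
(* This derivation kills the form of H, and Q' contains all other required powers. Its pairing with
   w is Q' times the coefficient of the wedge product. *)
have hD : Dmod alpha m (Q' *: (b j *: delta_mx 0 i + - b i *: delta_mx 0 j)).
  apply/DmodP => H'; rewrite der_applyZ.
  have [->|ne] := eqVneq H' H.
    rewrite der_applyD !der_applyZ !der_apply_delta -/(b i) -/(b j).
    by rewrite mulNr [b j * _]mulrC subrr mulr0; exists 0; rewrite mulr0.
  apply: divides_mulr; apply: (divides_lin_polyX_cancel (alpha_neq0 hA halpha H') (b := L ^+ m H)).
    by move=> /(lin_poly_primeX (alpha_neq0 hA halpha H')); apply: (alpha_coprime hA halpha); rewrite eq_sym.
  by rewrite -eQ; apply: divides_Qpoly.
have Q'0 : Q' != 0 by apply: contraNneq Q0 => h; rewrite eQ h mulr0 tofrac0.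
have [s] := hw _ hD; rewrite pairingZr => hs; exists s.
rewrite eQ -(tofrac_div_cancel (expf_neq0 (m H) L0) Q'0 hs).
rewrite /wedge !ratcoef_dform -!pairing_delta /pairing !mulr_suml -sumrB.
by apply: eq_bigr => k _; rewrite !mxE rmorphD !rmorphM rmorphN /=; ring.
Qed.

Variables (m m' : A -> nat) (H : A).
Hypothesis m'_neq : forall H', H' != H -> m' H' = m H'.
Hypothesis m'_H : m H = (m' H).+1.
Local Notation L := (lin_poly (alpha H)).

Theorem addition : multi_free alpha m' -> multi_free alpha m \/ multi_dual_SPOG alpha m.
Proof.
move=> Mfree; have [T [e [detT T_homog spanT]]] := Dmod_homogeneous_basis hA halpha Mfree.
have a0 := alpha_neq0 hA halpha H; have L0 := lin_poly_neq0 a0.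
have Tinj := row_mulmx_inj detT.
have sub := Dmod_sub (alpha := alpha) m'_neq m'_H; have step := Dmod_step hA halpha m'_neq m'_H.
have rowT j : Dmod alpha m' (row j T) by apply/spanT; exists (delta_mx 0 j); rewrite rowE.
have /fin_all_exists [g hg] j : divides (L ^+ m' H) (der_apply (row j T) L).
  by have /DmodP := rowT j.
have Dmod_g c : Dmod alpha m (c *m T) <-> divides L (\sum_j c 0 j * g j).
  apply: step; first by apply/spanT; exists c.
  rewrite der_apply_mulmx mulr_sumr; apply: eq_bigr => j _.
  by rewrite hg mulrCA.
have [Hd|g_nd] := classic (forall j, divides L (g j)).
  left; apply: free_module_ext Mfree => w; split; last exact: sub.
  move=> /spanT [c ->]; apply/Dmod_g; apply: divides_sum => j; exact: divides_mull.
(* The degree [e j] - [m' H] is written with two signs because the basis to which u will refer is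
   the dual one, of degrees - [e j]. *)
have g_homog j : poly_deg (- (m' H)%:Z - - (e j)%:Z) (g j).
  rewrite opprK addrC; apply: (poly_deg_divl (a := L ^+ m' H)).
  - by rewrite -[X in X.-homog]mul1n; apply/dhomogMn/lin_poly_homog.
  - exact: expf_neq0.
  - by rewrite -hg; apply: der_apply_homog => i; rewrite mxE; apply: T_homog.
have [k0 [u [h [u_homog h_nd u_nd gu prim]]]] := primitive_part a0 g_homog g_nd.
have Dmod_u c : Dmod alpha m (c *m T) <-> divides L (\sum_j c 0 j * u j).
  have eg : \sum_j c 0 j * g j = h * (\sum_j c 0 j * u j) + \sum_j c 0 j * (g j - h * u j).
    by rewrite mulr_sumr -big_split; apply: eq_bigr => j _ /=; ring.
  have hr : divides L (\sum_j c 0 j * (g j - h * u j)).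
    by apply: divides_sum => j; apply: divides_mull.
  rewrite Dmod_g; split=> [hd|hd]; last by rewrite eg; apply: dividesD => //; apply: divides_mull.
  have : divides L (h * (\sum_j c 0 j * u j)).
    rewrite -[X in divides _ X](addrK (\sum_j c 0 j * (g j - h * u j))) -eg.
    exact: dividesB.
  by case/(lin_poly_prime a0).
have [u0|/not_all_ex_not [i /eqP ui0]] := classic (forall j, (u j)@_0%MM = 0); last first.
  (* With u_i constant, the congruence sum_j c_j u_j = 0 mod L is solved for c_i; this gives the
     basis of D(A,m) made of L theta_i and theta_j - (u_j / u_i) theta_i. *)
  left; have [d _ hd] : exists2 d : nat, k0 - - (e i)%:Z = d & u i \is d.-homog.
    by apply: poly_deg_nat (u_homog i) _; apply: contraNneq ui0 => ->; rewrite mcoeff0.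
  have d0 := dhomog_const hd ui0; rewrite d0 in hd.
  have ui := dhomog0_const hd; set c0 := (u i)@_0%MM in ui0 ui.
  pose ci : S := c0^-1%:MP.
  have ciu : ci * u i = 1 by rewrite ui -mpolyCM mulVf.
  pose tail (c : 'I_l -> S) := \sum_(j | j != i) c j * u j.
  pose coords (c : 'I_l -> S) j := if j == i then L * c i - ci * tail c else c j.
  pose bs j := if j == i then L *: row i T else row j T - (ci * u j) *: row i T.
  have bsE c : \sum_j c j *: bs j = (\row_j coords c j) *m T.
    rewrite -row_poly_sum (bigD1 i) //= [RHS](bigD1 i) //= /bs /coords eqxx.
    rewrite scalerBl scalerA [c i * _]mulrC -addrA; congr (_ + _).
    have -> : - ((ci * tail c) *: row i T) = \sum_(j | j != i) (- (ci * (c j * u j))) *: row i T.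
      by rewrite -scaleNr /tail mulr_sumr -sumrN scaler_suml.
    rewrite -big_split /=.
    apply: eq_bigr => j /negPf ->; rewrite scalerBr scalerA addrC; congr (_ + _).
    by rewrite -scaleNr; congr (_ *: _); ring.
  exists l, bs; split=> [w|c]; last first.
    rewrite bsE => h0.
    have {h0}/rowP h0 : \row_j coords c j = 0 by apply: Tinj; rewrite h0 mul0mx.
    have hj j : j != i -> c j = 0.
      by move=> ne; have := h0 j; rewrite !mxE /coords (negPf ne).
    move=> j; have [->|/hj//] := eqVneq j i.
    have := h0 i; rewrite !mxE /coords eqxx /tail big1 => [|k ne]; last by rewrite hj ?mul0r.
    by rewrite mulr0 subr0 => /eqP; rewrite mulf_eq0 (negPf L0) => /eqP.
  split=> [hw|[c ->]]; last first.
    rewrite bsE; apply/Dmod_u; rewrite (bigD1 i) //= mxE /coords eqxx.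
    rewrite (eq_bigr (fun j => c j * u j)) => [|j ne]; last by rewrite mxE (negPf ne).
    rewrite -/(tail c); exists (c i * u i).
    have -> : (L * c i - ci * tail c) * u i + tail c
        = L * (c i * u i) + tail c * (1 - ci * u i) by ring.
    by rewrite ciu subrr mulr0 addr0.
  have /spanT [c ew] := sub _ hw; rewrite ew in hw *.
  (* Solving sum_j c_j u_j = L t for c_i gives the coefficient t / u_i of L theta_i. *)
  have /Dmod_u [t ht] := hw; exists (fun j => if j == i then ci * t else c 0 j).
  rewrite bsE; congr (_ *m _); apply/rowP => j; rewrite mxE /coords eqxx.
  case: eqP => [->|//].
  have -> : tail (fun j => if j == i then ci * t else c 0 j) = L * t - c 0 i * u i.
    rewrite -ht (bigD1 i) //= addrAC subrr add0r.
    by apply: eq_bigr => k /negPf ->.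
  by rewrite -[LHS]mulr1 -ciu; ring.
right; pose y := dual_row T.
(* Its pairing with c T is (sum_j c_j u_j) / L, which is a polynomial exactly on D(A,m). *)
pose phi : ratform K l := \row_i ((frac L)^-1 * ratcoef (\sum_j u j *: y j) i).
have fL0 : frac L != 0 by rewrite tofrac_eq0.
have phiE i : ratcoef phi i = (frac L)^-1 * ratcoef (\sum_j u j *: y j) i.
  by rewrite {1}/ratcoef mxE.
have L_phi : L *: phi = \sum_j u j *: y j.
  apply/rowP => i; rewrite -[LHS]/(ratcoef (L *: phi) i) ratcoefZ phiE mulVKf //.
have deg_y := dual_row_deg detT T_homog.
have deg_phi : form_deg (k0 - 1) phi.
  move=> i; rewrite phiE; apply: frac_deg_div => //; move: i.
  apply: (form_deg_sum a0) => j; rewrite -[k0](subrK (- (e j)%:Z)).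
  by apply: (form_degZ a0) => //; apply: deg_y.
have pair_row (d : 'rV[S]_l) j : pairing (y j) (d *m T) = frac (d 0 j).
  rewrite pairing_mulmx (bigD1 j) //= pairing_dual_row // eqxx mulr1 big1 ?addr0 // => i ne.
  by rewrite pairing_dual_row // (negPf ne) mulr0.
have M_gen w : Omega1 alpha m w <-> exists c b, w = \sum_j c j *: y j + b *: phi.
  rewrite Omega1_dual; split=> [hw|[c [b ->]] theta hD]; last first.
    have /spanT [d ed] := sub _ hD; rewrite ed in hD *.
    have /Dmod_u [t ht] := hD.
    exists (\sum_j c j * d 0 j + b * t).
    rewrite pairingD pairing_sum rmorphD rmorph_sum rmorphM /=; congr (_ + _).
      by apply: eq_bigr => j _; rewrite pairingZ pair_row rmorphM.
    rewrite pairingZ; congr (_ * _); apply: (mulfI fL0).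
    rewrite -pairingZ L_phi pairing_sum -rmorphM -ht rmorph_sum.
    by apply: eq_bigr => j _; rewrite pairingZ pair_row mulrC rmorphM.
  have /fin_all_exists [v hv] j : exists v, frac L * pairing w (row j T) = frac v.
    have [|v ev] := hw (L *: row j T); last by exists v; rewrite -ev pairingZr.
    exact: (Dmod_scale hA halpha m'_neq m'_H).
  (* The derivation u_j theta_i - u_i theta_j satisfies the congruence, so it lies in D(A,m); its
     pairing with w is (v_i u_j - v_j u_i) / L. *)
  have hpar i j : divides L (v i * u j - v j * u i).
    pose c : 'rV[S]_l := u j *: delta_mx 0 i + - u i *: delta_mx 0 j.
    have cE (x : 'I_l -> S) : \sum_k c 0 k * x k = u j * x i - u i * x j.
      have dE i' : \sum_k (delta_mx 0 i' : 'rV[S]_l) 0 k * x k = x i'.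
        rewrite (bigD1 i') //= mxE !eqxx mul1r big1 ?addr0 // => k ne.
        by rewrite mxE (negPf ne) andbF mul0r.
      rewrite -(dE i) -(dE j) !mulr_sumr -sumrB; apply: eq_bigr => k _.
      rewrite !mxE; ring.
    have [|s hs] := hw (c *m T).
      by apply/Dmod_u; rewrite cE mulrC subrr; exists 0; rewrite mulr0.
    exists s; apply/eqP; rewrite -tofrac_eq [X in _ == X]tofracM -hs pairing_mulmx mulr_sumr.
    apply/eqP; transitivity (frac (\sum_k c 0 k * v k)); first by rewrite cE; congr frac; ring.
    by rewrite rmorph_sum; apply: eq_bigr => k _ /=; rewrite tofracM -hv mulrCA.
  (* Since v is L times the coordinates of w in the dual basis, dividing v = b u + L c by L gives
     w. *)
  have [b /fin_all_exists [c hc]] := prim v hpar.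
  exists c, b; apply/rowP => i.
  rewrite -[LHS]/(ratcoef w i) -[RHS]/(ratcoef _ i) ratcoefD ratcoefZ phiE.
  rewrite (dual_row_expansion detT) mulrCA.
  have sumE (x : 'I_l -> S) : ratcoef (\sum_j x j *: y j) i = \sum_j frac (x j) * ratcoef (y j) i.
    by rewrite /ratcoef summxE; apply: eq_bigr => j _; rewrite !mxE.
  rewrite !sumE; apply: (mulfI fL0); rewrite mulrDr mulVKf // !mulr_sumr -big_split.
  apply: eq_bigr => j _ /=; rewrite mulrA hv.
  have -> : v j = b * u j + L * c j by rewrite -hc addrC subrK.
  by rewrite tofracD !tofracM; ring.
apply: (plus_one_SPOG (@form_degD K l) (form_degZ a0) deg_y (dual_row_indep detT)
    a0 L_phi deg_phi u_homog M_gen u0 u_nd).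
exact: lin_poly_prime.
Qed.

End Duality.

Theorem theorem3p9 (K : fieldType) (l : nat) (A : {fset {vspace 'rV[K]_l}})
    (alpha : A -> 'Hom('rV[K]_l, K^o)) (m : A -> nat) (H : A)
    (hA : is_arrangement A) (halpha : is_defining alpha)
    (hm : forall H' : A, (0 < m H')%N) :
  (multi_free alpha m ->
     multi_free alpha (fun H' => (m H' - delta H H')%N) \/
     multi_SPOG alpha (fun H' => (m H' - delta H H')%N)) /\
  (multi_free alpha (fun H' => (m H' - delta H H')%N) ->
     multi_free alpha m \/ multi_dual_SPOG alpha m).
Proof.
have m'_neq H' : H' != H -> (m H' - delta H H')%N = m H'.
  by rewrite /delta => /negPf ->; rewrite subn0.
(* Positivity of [m H] makes the truncated subtraction exact. *)
have m'_H : m H = (m H - delta H H).+1 by rewrite /delta eqxx subn1 prednK.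
split; first exact: (deletion hA halpha m'_neq m'_H).
exact: (addition hA halpha m'_neq m'_H).
Qed.
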